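(* Let $\gamma>-1$, let $\eta\in\mathbb{T}$, and let $\psi_{0,\eta}(w)=\eta w$ for $w\in\mathbb{D}$. Consider the (bounded) composition operator $C_{\psi_{0,\eta}}$ on $A^2_\gamma(\mathbb{D})$. Then $\mathbf{Ber}(C_{\psi_{0,\eta}})$ is a convex subset of $\mathbb{C}$ if and only if $\eta=1$ or $\eta=-1$.
   Context: $\mathbb{D}$ is the open unit disk and $\mathbb{T}$ the unit circle of $\mathbb{C}$; $dA$ is area measure on $\mathbb{D}$ normalized so that $\mathbb{D}$ has area $1$; $dA_\gamma(w)=(\gamma+1)(1-|w|^2)^\gamma dA(w)$. The weighted Bergman space $A^2_\gamma(\mathbb{D})$ is the Hilbert space of holomorphic functions $f$ on $\mathbb{D}$ with $\int_{\mathbb{D}}|f|^2dA_\gamma<\infty$, with inner product $\langle f,g\rangle=\int_{\mathbb{D}}f\bar g\,dA_\gamma$. Its normalized reproducing kernel at $\xi\in\mathbb{D}$ is $\hat k^\gamma_\xi(w)=\frac{(1-|\xi|^2)^{(\gamma+2)/2}}{(1-\bar\xi w)^{\gamma+2}}$ (principal branch of the power). For a holomorphic self-map $\psi$ of $\mathbb{D}$, the composition operator is $C_\psi f=f\circ\psi$. For a bounded linear operator $T$ on $A^2_\gamma(\mathbb{D})$, the Berezin transform is $\widetilde T(\xi)=\langle T\hat k^\gamma_\xi,\hat k^\gamma_\xi\rangle$, $\xi\in\mathbb{D}$, and the Berezin range is $\mathbf{Ber}(T)=\{\widetilde T(\xi):\xi\in\mathbb{D}\}$. *)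

(* Defs.v *)
From mathcomp Require Import all_boot all_order all_algebra.
From mathcomp Require Export complex.
From mathcomp Require Export all_classical all_reals all_analysis.

Set Implicit Arguments.
Unset Strict Implicit.
Unset Printing Implicit Defensive.

Import Order.TTheory GRing.Theory Num.Theory ComplexField.
Import numFieldNormedType.Exports.

Local Open Scope classical_set_scope.
Local Open Scope complex_scope.
Local Open Scope ring_scope.

(* Functions on the disk are represented by total functions R[i] -> R[i], of
   which only the values on [disk] matter. *)
Definition disk {R : realType} : set R[i] := [set z | `|z| < 1].

(* R[i]^o is R[i] as a normed space over itself, so that [derivable _ z 1] is
   complex differentiability at z. *)
Definition holomorphic_on_disk {R : realType} (f : R[i] -> R[i]) : Prop :=
  forall z : R[i], disk z -> derivable (f : R[i]^o -> R[i]^o) z 1.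

(* Argument in ]-pi, pi]; the value at 0 is junk. *)
Definition carg {R : realType} (z : R[i]) : R :=
  let t := acos (complex.Re z / Normc.normc z) in if 0 <= complex.Im z then t else - t.

(* Principal branch of z ^ s, for z != 0 and s real. *)
Definition cpow {R : realType} (z : R[i]) (s : R) : R[i] :=
  (Normc.normc z `^ s)%:C * (cos (s * carg z) +i* sin (s * carg z)).

Definition point {R : realType} (p : R * R) : R[i] := p.1 +i* p.2.

Definition lebesgue2 {R : realType} :
    {measure set (measurableTypeR R * measurableTypeR R) -> \bar R} :=
  (lebesgue_measure \x lebesgue_measure)%E.

(* Density of dA_gamma with respect to planar Lebesgue measure on the disk. *)
Definition weight {R : realType} (gamma : R) (z : R[i]) : R :=
  pi^-1 * (gamma + 1) * (1 - Normc.normc z ^+ 2) `^ gamma.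

(* Integral over the disk of a complex-valued function with respect to
   dA_gamma, taken componentwise. *)
Definition integral_dA {R : realType} (gamma : R) (f : R[i] -> R[i]) : R[i] :=
  (\int[lebesgue2]_(p in point @^-1` disk)
      (complex.Re (f (point p)) * weight gamma (point p)))
  +i*
  (\int[lebesgue2]_(p in point @^-1` disk)
      (complex.Im (f (point p)) * weight gamma (point p))).

Definition bergman {R : realType} (gamma : R) : set (R[i] -> R[i]) :=
  [set f | holomorphic_on_disk f /\
    (\int[lebesgue2]_(p in point @^-1` disk)
      (Normc.normc (f (point p)) ^+ 2 * weight gamma (point p))%:E < +oo)%E].

Definition inner {R : realType} (gamma : R) (f g : R[i] -> R[i]) : R[i] :=
  integral_dA gamma (fun w => f w * (g w)^*%C).

Definition bergman_norm {R : realType} (gamma : R) (f : R[i] -> R[i]) : R :=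
  Num.sqrt (complex.Re (inner gamma f f)).

Definition bounded_linear_operator {R : realType} (gamma : R)
    (T : (R[i] -> R[i]) -> (R[i] -> R[i])) : Prop :=
  [/\ forall f, bergman gamma f -> bergman gamma (T f),
      forall (a : R[i]) f g, bergman gamma f -> bergman gamma g ->
        forall w, disk w ->
          T (fun u => a * f u + g u) w = a * T f w + T g w
    & exists M : R, forall f, bergman gamma f ->
        bergman_norm gamma (T f) <= M * bergman_norm gamma f].

Definition normalized_kernel {R : realType} (gamma : R) (xi w : R[i]) : R[i] :=
  ((1 - Normc.normc xi ^+ 2) `^ ((gamma + 2) / 2))%:C
    / cpow (1 - xi^*%C * w) (gamma + 2).

Definition berezin {R : realType} (gamma : R)
    (T : (R[i] -> R[i]) -> (R[i] -> R[i])) (xi : R[i]) : R[i] :=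
  inner gamma (T (normalized_kernel gamma xi)) (normalized_kernel gamma xi).

Definition berezin_range {R : realType} (gamma : R)
    (T : (R[i] -> R[i]) -> (R[i] -> R[i])) : set R[i] :=
  berezin gamma T @` disk.

Definition composition_operator {R : realType} (psi : R[i] -> R[i])
    (f : R[i] -> R[i]) : R[i] -> R[i] := f \o psi.

Definition psi0 {R : realType} (eta w : R[i]) : R[i] := eta * w.

(* [Rcomplex R] is R[i] as a real vector space. *)
Definition convexC {R : realType} (A : set R[i]) : Prop :=
  convex_set (A : set (convex_lmodType (Rcomplex R))).

(* Main.v *)
From mathcomp Require Import all_boot all_order all_algebra.
Require Import Defs.
From mathcomp Require Import measurable_realfun ring lra.

(* A rotation preserves planar Lebesgue measure, being a product of shears.  Hence
   distinct monomials are orthogonal in the Bergman space, and the image of the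
   Lebesgue measure under w |-> |w|^2 being k times Lebesgue measure on the
   half-line (k the area of the disk), an integration by parts gives
   c_n ||w^n||^2 = ||1||^2, where (1 - z)^(- s) = sum_n c_n z^n and s = gamma + 2.
   Expanding the kernels, B(xi) = K ((1 - r) / (1 - eta r))^s with r = |xi|^2 and
   K = k / pi; that k = pi is not needed, since K > 0 only rescales the range.
   If eta = 1 or -1 this describes a point or a real interval.  Otherwise |B| is
   injective in r, B(0) = K and B(xi) -> 0 as r -> 1.  If the range is convex, then
   on the segment from B(xi2) to K there is a point of modulus |B(xi1)|, which is
   B(xi1) by injectivity; letting B(xi2) -> 0 makes B(xi1) real.  For small r the
   argument - s arg(1 - eta r) then vanishes, so eta is real. *)

Set Implicit Arguments.
Unset Strict Implicit.
Unset Printing Implicit Defensive.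

Import Order.TTheory GRing.Theory Num.Theory.
Import numFieldNormedType.Exports.

Local Open Scope classical_set_scope.
Local Open Scope complex_scope.
Local Open Scope ring_scope.

(** * Rotation invariance of planar Lebesgue measure *)

(** The principal branch is only ever expanded at points 1 - z with |z| < 1. Their real part is
    positive, so the argument is an arctangent and the binomial expansion becomes a real-variable
    statement on the segment from 0 to z. There the partial sum P_N of (1 - z)^(- s) satisfies the
    differential equation of the full series up to a single term, so P_N (1 - z)^s stays close to 1
    by the mean value theorem. Since the coefficients are positive, partial sums on |u| <= rho < 1
    are bounded by their values at rho, which permits the passage to the limit under the integral.
    As gamma may be negative, the radial integrals can be singular at 1 and are reached from [0, b]
    with b < 1. Boundedness of the operator concerns arbitrary Bergman functions, which is why
    measurability of holomorphic functions is derived at the end. *)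

Section line.
Context {R : realType}.
Local Notation lam := (@lebesgue_measure R).

(** Lebesgue measure is determined by its values on half-open intervals, so only those have to be
    compared; the same holds for dilations. *)
Lemma lebesgue_measure_shift (c : R) (A : set R) : measurable A ->
  lam ((fun x => x + c) @^-1` A) = lam A.
Proof.
have mf : measurable_fun [set: R] (fun x : R => x + c).
  by apply: measurable_funD => //; exact: measurable_cst.
move=> mA.
rewrite -[LHS]/(pushforward lam (fun x => x + c : measurableTypeR R) A).
apply/esym/lebesgue_measure_unique => //= _ [[a b] _ <-]; rewrite /pushforward.
have -> : (fun x : R => x + c) @^-1` `]a, b] = `](a - c), (b - c)]%classic.
  by apply/seteqP; split => x /=; rewrite !in_itv/= ltrBlDr lerBrDr.
rewrite !lebesgue_measure_itv/= !lte_fin ltrD2r -!EFinB.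
by case: ifP => // _; congr EFin; ring.
Qed.

Lemma lebesgue_measure_dilate (c : R) (A : set R) : 0 < c -> measurable A ->
  (c%:E * lam ((fun x => c * x)%R @^-1` A))%E = lam A.
Proof.
move=> c0.
have mf : measurable_fun [set: R] (fun x : R => c * x).
  by apply: measurable_funM => //; exact: measurable_cst.
move=> mA.
pose m : {measure set (measurableTypeR R) -> \bar R} :=
  pushforward lam (fun x => c * x : measurableTypeR R).
rewrite -[LHS]/(mscale (NngNum (ltW c0)) (m mf) A).
apply/esym/lebesgue_measure_unique => //= _ [[a b] _ <-].
rewrite /mscale/= /pushforward.
have -> : (fun x : R => c * x) @^-1` `]a, b] = `](a / c), (b / c)]%classic.
  by apply/seteqP; split => x /=; rewrite !in_itv/= ltr_pdivrMr// ler_pdivlMr//;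
  rewrite !(mulrC _ x).
rewrite !lebesgue_measure_itv/= !lte_fin ltr_pM2r ?invr_gt0//.
case: ifP => [|_]; last by rewrite mule0.
by move=> _; rewrite -!EFinB -EFinM; congr EFin; field; lra.
Qed.

End line.

Section plane.
Context {R : realType}.
Local Notation lam := (@lebesgue_measure R).
Local Notation mu := (@lebesgue2 R).
Local Notation R2 := (measurableTypeR R * measurableTypeR R)%type.

Lemma lebesgue2E1 (A : set R2) : mu A = (\int[lam]_x lam (xsection A x))%E.
Proof. by []. Qed.

(** Tonelli for sets: [lebesgue2] is built from vertical sections, while a horizontal shear has to
    be analysed on horizontal ones. *)
Lemma lebesgue2E2 (A : set R2) : measurable A ->
  mu A = (\int[lam]_y lam (ysection A y))%E.
Proof.
move=> mA.
rewrite -[RHS]/((lam \x^ lam)%E A).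
apply: (@product_measure_unique _ _ _ _ _ lam lam) => //= B C mB mC.
by rewrite product_measure2E.
Qed.

Definition measure_preserving (f : R2 -> R2) : Prop :=
  measurable_fun [set: R2] f /\
  forall A : set R2, measurable A -> mu (f @^-1` A) = mu A.

Lemma measure_preserving_comp (f g : R2 -> R2) :
  measure_preserving f -> measure_preserving g -> measure_preserving (f \o g).
Proof.
move=> [mf pf] [mg pg]; split; first exact: measurableT_comp.
move=> A mA; rewrite comp_preimage pg ?pf//.
by rewrite -[X in measurable X]setTI; exact: mf.
Qed.

Definition shear1 (a : R) (p : R2) : R2 := (p.1 + a * p.2, p.2).
Definition shear2 (a : R) (p : R2) : R2 := (p.1, p.2 + a * p.1).

(** On each horizontal line the shear is a translation; [shear2] is the same on vertical lines. *)
Lemma measure_preserving_shear1 a : measure_preserving (shear1 a).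
Proof.
have m1 : measurable_fun [set: R2] (shear1 a).
  apply/measurable_fun_pair; last exact: measurable_snd.
  apply: measurable_funD; first exact: measurable_fst.
  by apply: measurable_funM; [exact: measurable_cst|exact: measurable_snd].
split; first exact: m1.
move=> A mA.
have mpA : measurable (shear1 a @^-1` A).
  by rewrite -[X in measurable X]setTI; exact: m1.
rewrite !lebesgue2E2//; apply: eq_integral => y _.
rewrite -[RHS](lebesgue_measure_shift (a * y)); last exact: measurable_ysection.
by congr (lam _); apply/seteqP; split => x; rewrite /ysection/= !inE.
Qed.

Lemma measure_preserving_shear2 a : measure_preserving (shear2 a).
Proof.
have m1 : measurable_fun [set: R2] (shear2 a).
  apply/measurable_fun_pair; first exact: measurable_fst.
  apply: measurable_funD; first exact: measurable_snd.
  by apply: measurable_funM; [exact: measurable_cst|exact: measurable_fst].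
split; first exact: m1.
move=> A mA.
rewrite !lebesgue2E1//; apply: eq_integral => x _.
rewrite -[RHS](lebesgue_measure_shift (a * x)); last exact: measurable_xsection.
by congr (lam _); apply/seteqP; split => y; rewrite /xsection/= !inE.
Qed.

Definition rotation (c s : R) (p : R2) : R2 :=
  (c * p.1 - s * p.2, s * p.1 + c * p.2).

(* A rotation of angle t != pi is the product of the shears of parameters
   - tan (t / 2), sin t and - tan (t / 2). *)
Lemma measure_preserving_rotation c s :
  c ^+ 2 + s ^+ 2 = 1 -> measure_preserving (rotation c s).
Proof.
have three c' s' : c' ^+ 2 + s' ^+ 2 = 1 -> c' != -1 ->
    measure_preserving (rotation c' s').
  move=> cs c1.
  have c10 : 1 + c' != 0 by rewrite addrC addr_eq0.
  (* Half-angle formula: tan (t / 2) = sin t / (1 + cos t), which is why c' = -1 is excluded. *)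
  pose t := - (s' / (1 + c')).
  have -> : rotation c' s' = shear1 t \o (shear2 s' \o shear1 t).
    apply/funext => -[x y]; rewrite /rotation /shear1 /shear2/= /t.
    have s2 : s' ^+ 2 = (1 - c') * (1 + c') by rewrite -[s' ^+ 2](addKr (c' ^+ 2)) cs; ring.
    have E1 : s' * (s' / (1 + c')) = 1 - c' by rewrite mulrA -expr2 s2 mulfK.
    have E2 : s' / (1 + c') * (1 + c') = s' by rewrite mulfVK.
    set u := s' / (1 + c') in E1 E2 *.
    congr pair; last by nra.
    have -> : x + - u * y + - u * (y + s' * (x + - u * y)) =
       x - u * y - u * y - (s' * u) * x + (s' * u) * u * y by ring.
    rewrite E1.
    have -> : x - u * y - u * y - (1 - c') * x + (1 - c') * u * y =
       c' * x - u * (1 + c') * y by ring.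
    by rewrite E2.
  by do 2?apply: measure_preserving_comp;
    [exact: measure_preserving_shear1|exact: measure_preserving_shear2|
     exact: measure_preserving_shear1].
move=> cs; have [c1|] := eqVneq c (-1); last exact: three.
have s0 : s = 0.
  by apply/eqP; rewrite -sqrf_eq0 -[s ^+ 2](addKr (c ^+ 2)) cs c1; apply/eqP; ring.
(* The half-turn, excluded above, is the square of the quarter-turn. *)
have -> : rotation c s = rotation 0 1 \o rotation 0 1.
  apply/funext => -[x y]; rewrite /rotation/= c1 s0; congr pair; ring.
have N1 : 0 != -1 :> R by rewrite eq_sym oppr_eq0 oner_eq0.
by apply: measure_preserving_comp; apply: three => //; ring.
Qed.

Definition dilation (c : R) (p : R2) : R2 := (c * p.1, c * p.2).

(** One factor c per coordinate, checked on rectangles, which determine a product measure. This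
    scaling is what makes the area of a disk proportional to the square of its radius. *)
Lemma lebesgue2_dilation (c : R) (A : set R2) : 0 < c -> measurable A ->
  ((c ^+ 2)%:E * mu (dilation c @^-1` A))%E = mu A.
Proof.
move=> c0 mA.
have mf : measurable_fun [set: R2] (dilation c).
  apply/measurable_fun_pair; apply: measurable_funM; try exact: measurable_cst.
  - exact: measurable_fst.
  - exact: measurable_snd.
pose m : {measure set R2 -> \bar R} := pushforward mu (dilation c).
rewrite -[LHS]/(mscale (NngNum (exprn_ge0 2 (ltW c0))) (m mf) A).
apply/esym/product_measure_unique => //= B C mB mC.
rewrite /mscale/= /pushforward.
have -> : dilation c @^-1` (B `*` C) =
  ((fun x => c * x) @^-1` B) `*` ((fun x => c * x) @^-1` C) by [].
have mc : measurable_fun [set: R] (fun x : R => c * x).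
  by apply: measurable_funM => //; exact: measurable_cst.
have mpre (D : set R) : measurable D -> measurable ((fun x => c * x) @^-1` D).
  by move=> mD; rewrite -[X in measurable X]setTI; exact: mc.
rewrite /lebesgue2 product_measure1E; [|exact: mpre|exact: mpre].
rewrite -(lebesgue_measure_dilate c0 mB) -(lebesgue_measure_dilate c0 mC).
by rewrite expr2 EFinM muleACA.
Qed.

End plane.

(** * Radial integrals *)

Section radial.
Context {R : realType}.
Local Notation lam := (@lebesgue_measure R).
Local Notation mu := (@lebesgue2 R).
Local Notation R2 := (measurableTypeR R * measurableTypeR R)%type.

Lemma lebesgue2X (A B : set (measurableTypeR R)) : measurable A -> measurable B ->
  mu (A `*` B) = (lam A * lam B)%E.
Proof. exact: product_measure1E. Qed.

(** The squared modulus is chosen over the modulus because its image measure on the half-line is a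
    constant multiple of Lebesgue measure, with no Jacobian left. *)
Definition sqnorm (p : R2) : measurableTypeR R := p.1 ^+ 2 + p.2 ^+ 2.

Lemma sqnorm_ge0 p : 0 <= sqnorm p.
Proof. by rewrite addr_ge0// sqr_ge0. Qed.

Lemma measurable_sqnorm : measurable_fun [set: R2] sqnorm.
Proof.
by apply: measurable_funD; apply: measurable_funX;
  [exact: measurable_fst|exact: measurable_snd].
Qed.

Lemma measurable_sqnorm_preimage (A : set (measurableTypeR R)) :
  measurable A -> measurable (sqnorm @^-1` A).
Proof. by move=> mA; rewrite -[X in measurable X]setTI; exact: measurable_sqnorm. Qed.

(** [fine] would turn an infinite area into 0; the comparisons with a circumscribed and an inscribed
    square below show that the area is finite and positive. *)
Definition disk_area : R := fine (mu (sqnorm @^-1` `]-oo, 1%R])).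

Let measurable_unit_disk : measurable (sqnorm @^-1` `]-oo, 1%R]).
Proof. exact: measurable_sqnorm_preimage. Qed.

Lemma lebesgue2_disk_fin : (mu (sqnorm @^-1` `]-oo, 1%R]) < +oo)%E.
Proof.
have mI : measurable (`[-1, 1]%classic : set (measurableTypeR R)) by [].
apply: (@le_lt_trans _ _ (mu (`[-1, 1] `*` `[-1, 1]))).
  apply: le_measure; rewrite ?inE//; first exact: measurableX.
  move=> [x y] /=; rewrite !in_itv/= /sqnorm/= => h.
  by split; apply/andP; split; nra.
rewrite lebesgue2X// lebesgue_measure_itv/=.
by case: ifP => _; rewrite ?mule0 ?lte0y// -EFinB -EFinM ltry.
Qed.

Lemma lebesgue2_diskE : mu (sqnorm @^-1` `]-oo, 1%R]) = disk_area%:E.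
Proof. by rewrite /disk_area fineK// ge0_fin_numE// lebesgue2_disk_fin. Qed.

Lemma disk_area_gt0 : 0 < disk_area.
Proof.
have mI : measurable (`[0, 2^-1]%classic : set (measurableTypeR R)) by [].
rewrite -lte_fin -lebesgue2_diskE.
apply: (@lt_le_trans _ _ (mu (`[0, 2^-1] `*` `[0, 2^-1]))); last first.
  apply: le_measure; rewrite ?inE//; first exact: measurableX.
  by move=> [x y] /=; rewrite !in_itv/= /sqnorm/= => -[/andP[? ?] /andP[? ?]]; nra.
rewrite lebesgue2X// lebesgue_measure_itv/= lte_fin invr_gt0 ltr0n.
by rewrite oppr0 adde0 -EFinM lte_fin mulr_gt0// invr_gt0.
Qed.

(** Covers the disk of radius 0, which is not a dilate of the unit disk. *)
Lemma lebesgue2_origin : mu (sqnorm @^-1` [set 0]) = 0%E.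
Proof.
have -> : sqnorm @^-1` [set 0] = [set 0] `*` [set 0].
  apply/seteqP; split => -[x y]; rewrite /sqnorm/=; last first.
    by move=> [-> ->]; rewrite expr0n addr0.
  move/eqP; rewrite paddr_eq0 ?sqr_ge0// !sqrf_eq0.
  by move=> /andP[/eqP -> /eqP ->].
rewrite lebesgue2X//; try exact: measurable_set1.
by rewrite lebesgue_measure_set1 mul0e.
Qed.

(** For t > 0 the disk is a dilate of the unit disk by the square root of t. The maximum makes the
    formula hold for every real t, so that annuli can be indexed by arbitrary intervals ]a, b]. *)
Lemma lebesgue2_closed_disk t :
  mu (sqnorm @^-1` `]-oo, t]) = (disk_area * Num.max t 0)%:E.
Proof.
have [t0|t0|->] := ltgtP t 0; rewrite ?mulr0.
- rewrite (_ : _ @^-1` _ = set0) ?measure0//.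
  apply/seteqP; split => p //=; rewrite in_itv/= => h.
  by have := le_lt_trans h t0; rewrite ltNge sqnorm_ge0.
- rewrite -(@lebesgue2_dilation _ (Num.sqrt t)) ?sqrtr_gt0//; last first.
    exact: measurable_sqnorm_preimage.
  rewrite sqr_sqrtr ?ltW// mulrC EFinM -lebesgue2_diskE; congr (_ * mu _)%E.
  apply/seteqP; split => p /=; rewrite !in_itv/= /sqnorm/= !exprMn;
    by rewrite sqr_sqrtr ?(ltW t0)// -mulrDr ger_pMr.
- rewrite -[RHS]lebesgue2_origin; congr (mu _).
  apply/seteqP; split => p /=; rewrite in_itv/=; last by move=> ->.
  by move=> h; apply/eqP; rewrite eq_le h sqnorm_ge0.
Qed.

Lemma lebesgue2_annulus (a b : R) : a <= b ->
  mu (sqnorm @^-1` `]a, b]) = (disk_area * (Num.max b 0 - Num.max a 0))%:E.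
Proof.
move=> ab.
have -> : sqnorm @^-1` `]a, b] =
    (sqnorm @^-1` `]-oo, b]) `\` (sqnorm @^-1` `]-oo, a]).
  apply/seteqP; split => p /=; rewrite !in_itv/=.
    by move=> /andP[h ->]; split=> //; apply/negP; rewrite -ltNge.
  by move=> [-> /negP]; rewrite -ltNge => ->.
rewrite measureD; try exact: measurable_sqnorm_preimage; last first.
  by rewrite [X in (X < _)%E]lebesgue2_closed_disk ltry.
rewrite (_ : _ `&` _ = sqnorm @^-1` `]-oo, a]); last first.
  apply/seteqP; split => p /=; rewrite !in_itv/=; first by case.
  by move=> h; split=> //; exact: le_trans ab.
by rewrite mulrBr EFinB; congr (_ - _)%E; exact: lebesgue2_closed_disk.
Qed.

(* The image of planar Lebesgue measure under sqnorm, together with a multiple of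
   Lebesgue measure on the negative half-line, is a multiple of Lebesgue measure. *)
Lemma lebesgue2_sqnorm (A : set (measurableTypeR R)) : measurable A ->
  A `<=` `[0, +oo[ -> mu (sqnorm @^-1` A) = (disk_area%:E * lam A)%E.
Proof.
move=> mA A0.
have mneg : measurable (`]-oo, 0]%classic : set (measurableTypeR R)) by [].
have ki : 0 <= disk_area^-1 by rewrite invr_ge0 ltW// disk_area_gt0.
pose p : {measure set (measurableTypeR R) -> \bar R} :=
  pushforward mu sqnorm.
pose m : {measure set (measurableTypeR R) -> \bar R} :=
  measure_add (mscale (NngNum ki) (p measurable_sqnorm)) (mrestr lam mneg).
have mE X : m X = ((disk_area^-1)%:E * mu (sqnorm @^-1` X) + lam (X `&` `]-oo, 0%R]))%E.
  exact: measure_addE.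
have k0 : disk_area != 0 by rewrite gt_eqF// disk_area_gt0.
have -> : lam A = m A.
  apply: lebesgue_measure_unique => // _ [[a b] _ <-]; rewrite mE/=.
  have [ab|ba] := ltP a b; last first.
    rewrite set_itv_ge ?bnd_simp -?leNgt// preimage_set0 set0I.
    by rewrite !measure0 mule0 adde0.
  rewrite lebesgue2_annulus ?ltW// -EFinM mulrA mulVf// mul1r.
  have -> : `]a, b] `&` `]-oo, 0] = `]a, (Num.min b 0)]%classic.
    apply/seteqP; split => x /=; rewrite !in_itv/= le_min.
      by move=> [/andP[-> ->] ->].
    by move=> /and3P[-> -> ->].
  rewrite !lebesgue_measure_itv/= !lte_fin ab.
  case: ifPn; rewrite ?lt_min ?negb_and -?EFinB -?EFinD => h; congr EFin.
    by move/andP: h => [_ a0]; rewrite (max_r (ltW a0)); case: (leP b 0) => ?; ring.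
  move: h; rewrite ab/= -leNgt => a0.
  by rewrite (max_l a0) (max_l (le_trans a0 (ltW ab))); ring.
rewrite mE.
(* The Lebesgue part added on the negative side meets A at most in the point 0. *)
have -> : lam (A `&` `]-oo, 0]) = 0%E.
  apply/eqP; rewrite eq_le measure_ge0 andbT -(lebesgue_measure_set1 (0:R)).
  apply: le_measure; rewrite ?inE; [exact: measurableI|exact: measurable_set1|].
  move=> x /= [/A0 /=]; rewrite !in_itv/= andbT => x0 x1.
  by apply/eqP; rewrite eq_le x1 x0.
by rewrite adde0 muleA -EFinM divff// mul1e.
Qed.

(** This takes the place of polar coordinates: both sides integrate f against measures that agree on
    the measurable subsets of [0, 1[. *)
Lemma integral_radial (f : measurableTypeR R -> \bar R) :
  measurable_fun (`[0, 1[%classic : set (measurableTypeR R)) f ->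
  (forall t, 0 <= t < 1 -> (0 <= f t)%E) ->
  (\int[mu]_(p in sqnorm @^-1` `[0%R, 1%R[) f (sqnorm p) =
   disk_area%:E * \int[lam]_(t in `[0%R, 1%R[) f t)%E.
Proof.
move=> mf f0.
have m01 : measurable (`[0, 1[%classic : set (measurableTypeR R)) by [].
have k0 : 0 <= disk_area by rewrite ltW// disk_area_gt0.
rewrite -[disk_area%:E]/((NngNum k0)%:num%:E) -ge0_integral_mscale//.
rewrite -(@ge0_integral_pushforward _ _ _ _ _ _ measurable_sqnorm mu)//; last first.
  by move=> t; rewrite inE/= in_itv/= => /f0.
pose p : {measure set (measurableTypeR R) -> \bar R} := pushforward mu sqnorm.
apply: (@eq_measure_integral _ _ _ _ _ (p measurable_sqnorm)).
move=> A mA A01; apply: lebesgue2_sqnorm => //.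
by apply: subset_trans A01 _ => x /=; rewrite !in_itv/= => /andP[-> _].
Qed.

End radial.

(** * Moments of the radial weight *)

Lemma is_derive_expr {R : realType} n (t : R) :
  is_derive t 1 (fun u : R => u ^+ n) (n%:R * t ^+ n.-1).
Proof.
have := @is_deriveX R _ id n t 1 1 (is_derive_id t 1).
by rewrite exprfctE /GRing.scale/= mulr1.
Qed.

Section moments.
Context {R : realType}.
Local Notation lam := (@lebesgue_measure R).
Local Notation I01 := (`[0, 1[%classic : set (measurableTypeR R)).

(** Stopping at b < 1 avoids the singularity of (1 - t)^gamma at 1 for negative gamma. Assuming
    differentiability for all t < 1, negative ones included, makes the endpoint 0 an interior
    point. *)
Lemma FTC_lt1 (f F : R -> R) (b : R) : 0 <= b -> b < 1 ->
  (forall t : R, t < 1 -> is_derive t 1 F (f t)) ->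
  (forall t : R, t < 1 -> {for t, continuous f}) ->
  (\int[lam]_(t in `[0%R, b]) (f t)%:E = (F b - F 0)%:E)%E.
Proof.
move=> b0 b1 dF cf.
have cF t : t < 1 -> {for t, continuous F}.
  move=> /dF [dFt _]; exact/differentiable_continuous/derivable1_diffP.
move: b0; rewrite le_eqVlt => /orP[/eqP <-|b0].
  by rewrite set_itv1 integral_set1 subrr.
rewrite (@continuous_FTC2 _ f F)//.
- by apply/continuous_in_subspaceT => t; rewrite inE/= in_itv/= => /andP[_ tb];
    apply: cf; exact: le_lt_trans b1.
- split.
  + by move=> t; rewrite in_itv/= => /andP[_ tb]; have [] := dF t (lt_trans tb b1).
  + by apply: cvg_at_right_filter; apply: cF.
  + by apply: cvg_at_left_filter; apply: cF.
- move=> t; rewrite in_itv/= => /andP[_ tb].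
  by rewrite derive1E; apply: derive_val; apply: dF; exact: lt_trans b1.
Qed.

(** Monotone convergence recovers the integral up to the singular endpoint from the intervals to
    which [FTC_lt1] applies. *)
Lemma cvg_integral_itvco (f : R -> R) : measurable_fun I01 f ->
  (forall t, 0 <= t < 1 -> 0 <= f t) ->
  (\int[lam]_(t in `[0%R, (1 - n.+1%:R^-1)%R]) (f t)%:E @[n --> \oo] -->
   \int[lam]_(t in `[0%R, 1%R[) (f t)%:E)%E.
Proof.
move=> mf f0.
have b1 n : 1 - n.+1%:R^-1 < 1 :> R by rewrite ltrBlDr ltrDl invr_gt0 ltr0n.
rewrite itv_bnd_open_bigcup; apply: ge0_nondecreasing_set_cvg_integral.
- move=> m n mn; rewrite subsetEset => t /=; rewrite !in_itv/= => /andP[-> h]/=.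
  by apply: le_trans h _; rewrite lerD2l lerN2 lef_pV2 ?posrE ?ltr0n// ler_nat ltnS.
- by move=> n.
- move=> n; apply/measurable_EFinP; apply: measurable_funS mf => //.
  by move=> t /=; rewrite !in_itv/= => /andP[-> h]/=; exact: le_lt_trans (b1 n).
- move=> n t /=; rewrite !in_itv/= => /andP[h0 h]; rewrite lee_fin f0// h0/=.
  exact: le_lt_trans (b1 n).
Qed.

Lemma is_derive_powR1B (a t : R) : t < 1 ->
  is_derive t 1 (fun u : R => (1 - u) `^ a) (- (a * (1 - t) `^ (a - 1))).
Proof.
move=> t1.
have d1 : is_derive t 1 (fun u : R => 1 - u) (- 1).
  by rewrite -(sub0r 1); exact: is_deriveB.
have h : 0 < 1 - t by rewrite subr_gt0.
have := @is_derive1_comp _ (fun u => u `^ a) (fun u => 1 - u) t _ _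
  (is_derive1_powR a h) d1.
by rewrite mulrN1.
Qed.

Lemma continuous_powR1B (a t : R) : t < 1 ->
  {for t, continuous (fun u : R => (1 - u) `^ a)}.
Proof.
move=> /(is_derive_powR1B a)[d _].
exact/differentiable_continuous/derivable1_diffP.
Qed.

(** At t = 1 - 1 / (n + 1) this is (1 - t)^a, the boundary term of the integrations below, with a =
    gamma + 1 > 0. *)
Lemma cvg_harmonic_powR (a : R) : 0 < a -> n.+1%:R^-1 `^ a @[n --> \oo] --> (0 : R).
Proof.
move=> a0; have h : (harmonic : R^nat) n @[n --> \oo] --> 0^'+.
  move=> P /= P0; have := @cvg_harmonic R _ P0; rewrite /nbhs/=.
  by apply: filterS => n; apply; rewrite invr_gt0 ltr0n.
exact: (cvg_comp (harmonic : R^nat) (fun x => x `^ a) h (powR_cvg0 a0)).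
Qed.

Variable gamma : R.
Hypothesis gamma_gt : -1 < gamma.

Definition beta_integrand (n : nat) (t : R) : R := t ^+ n * (1 - t) `^ gamma.

(** The Beta value B(n + 1, gamma + 1). *)
Definition moment (n : nat) : R := \int[lam]_(t in `[0, 1[) beta_integrand n t.

Lemma beta_integrand_ge0 n t : 0 <= t -> 0 <= beta_integrand n t.
Proof. by move=> t0; rewrite mulr_ge0 ?exprn_ge0 ?powR_ge0. Qed.

Lemma continuous_beta_integrand n t : t < 1 -> {for t, continuous (beta_integrand n)}.
Proof.
move=> t1; apply: continuousM; last exact: continuous_powR1B.
exact: exprn_continuous.
Qed.

Lemma measurable_beta_integrand n : measurable_fun [set: R] (beta_integrand n).
Proof.
apply: measurable_funM; first exact: measurable_funX.
apply: (measurableT_comp (measurable_powR gamma)).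
by apply: measurable_funB => //; exact: measurable_cst.
Qed.

Let gamma1_gt0 : 0 < gamma + 1.
Proof. by rewrite -ltrBlDr sub0r. Qed.

Lemma integral_beta_integrand0 n :
  (\int[lam]_(t in `[0%R, (1 - n.+1%:R^-1)%R]) (beta_integrand 0 t)%:E =
   ((gamma + 1)^-1 * (1 - n.+1%:R^-1 `^ (gamma + 1)))%:E)%E.
Proof.
have b1 : 1 - n.+1%:R^-1 < 1 :> R by rewrite ltrBlDr ltrDl invr_gt0 ltr0n.
have b0 : 0 <= 1 - n.+1%:R^-1 :> R by rewrite subr_ge0 invf_le1 ?ler1n// ltr0n.
have dG (t : R) : t < 1 ->
    is_derive t 1 (fun u : R => - (gamma + 1)^-1 * (1 - u) `^ (gamma + 1)) (beta_integrand 0 t).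
  move=> t1; have := is_derive_powR1B (gamma + 1) t1.
  move=> /(is_deriveZ (- (gamma + 1)^-1)); rewrite addrK.
  rewrite /beta_integrand expr0 mul1r /GRing.scale/= mulrNN mulrA mulVf ?mul1r//.
  by rewrite gt_eqF.
rewrite (FTC_lt1 b0 b1 dG (@continuous_beta_integrand 0)) subr0 powR1 subKr.
by congr EFin; ring.
Qed.

Let cvg_beta_integrand n :
  (\int[lam]_(t in `[0%R, (1 - k.+1%:R^-1)%R]) (beta_integrand n t)%:E @[k --> \oo] -->
   \int[lam]_(t in `[0%R, 1%R[) (beta_integrand n t)%:E)%E.
Proof.
apply: cvg_integral_itvco; first exact: measurable_funTS (measurable_beta_integrand n).
by move=> t /andP[t0 _]; exact: beta_integrand_ge0.
Qed.

Lemma integral_beta_integrand0_itvco :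
  (\int[lam]_(t in `[0%R, 1%R[) (beta_integrand 0 t)%:E = ((gamma + 1)^-1)%:E)%E.
Proof.
apply: (cvg_unique _ (@cvg_beta_integrand 0)) => //.
rewrite /=; under eq_fun => k do rewrite integral_beta_integrand0.
apply: cvg_EFin; first exact: nearW.
rewrite -[X in _ --> X]mulr1 -[X in _ * X]subr0 /=.
apply: cvgM; first exact: cvg_cst.
by apply: cvgB; [exact: cvg_cst|exact: cvg_harmonic_powR].
Qed.

(** As t^n <= 1 on [0, 1[, every n is dominated by the case n = 0, whose integral has just been
    found finite. *)
Lemma integrable_beta_integrand n : lam.-integrable I01 (EFin \o beta_integrand n).
Proof.
have m01 : measurable I01 by [].
apply: (@le_integrable _ _ _ _ _ m01 _ (EFin \o beta_integrand 0)).
- by apply/measurable_EFinP; apply: measurable_funTS; exact: measurable_beta_integrand.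
- move=> t /=; rewrite in_itv/= => /andP[t0 t1].
  rewrite lee_fin !ger0_norm ?beta_integrand_ge0//.
  rewrite /beta_integrand expr0 mul1r ler_piMl ?powR_ge0//.
  by rewrite exprn_ile1// ltW.
apply/integrableP; split.
  by apply/measurable_EFinP; apply: measurable_funTS; exact: measurable_beta_integrand.
under eq_integral => t.
  rewrite inE/= in_itv/= => /andP[t0 t1].
  rewrite ger0_norm ?beta_integrand_ge0//.
over.
by rewrite integral_beta_integrand0_itvco ltry.
Qed.

Lemma momentE n : (\int[lam]_(t in `[0%R, 1%R[) (beta_integrand n t)%:E = (moment n)%:E)%E.
Proof.
rewrite /moment /Rintegral fineK//.
by apply: integrable_fin_num => //; exact: integrable_beta_integrand.
Qed.

Lemma moment0 : moment 0 = (gamma + 1)^-1.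
Proof. by rewrite /moment /Rintegral integral_beta_integrand0_itvco. Qed.

Lemma moment_rec n : (n.+1%:R + gamma + 1) * moment n.+1 = n.+1%:R * moment n.
Proof.
(* Integration by parts: F vanishes at 0 and, as gamma + 1 > 0, tends to 0 at 1. Splitting one
   factor 1 - t off (1 - t)^(gamma + 1) expresses F' through two consecutive integrands. *)
pose F (t : R) := t ^+ n.+1 * (1 - t) `^ (gamma + 1).
pose f t := n.+1%:R * beta_integrand n t - (n.+1%:R + gamma + 1) * beta_integrand n.+1 t.
have dF (t : R) : t < 1 -> is_derive t 1 F (f t).
  move=> t1; have d1 := is_derive_powR1B (gamma + 1) t1.
  have d2 : is_derive t 1 (fun u : R => u ^+ n.+1) (n.+1%:R * t ^+ n).
    exact: is_derive_expr.
  rewrite /F; apply: (is_derive_eq (is_deriveM d2 d1)).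
  rewrite /f /beta_integrand /GRing.scale/= addrK exprS.
  rewrite powRD; last by rewrite subr_eq0 gt_eqF ?implybT.
  by rewrite powRr1 ?subr_ge0 ?ltW//; ring.
have cf (t : R) : t < 1 -> {for t, continuous f}.
  move=> t1; apply: continuousB; apply: continuousM; try exact: cst_continuous;
  exact: continuous_beta_integrand.
pose b k : R := 1 - k.+1%:R^-1.
have b1 k : b k < 1 by rewrite /b ltrBlDr ltrDl invr_gt0 ltr0n.
have b0 k : 0 <= b k by rewrite /b subr_ge0 invf_le1 ?ler1n// ltr0n.
have cvm m : (\int[lam]_(t in `[0, b k]) beta_integrand m t) @[k --> \oo] --> moment m.
  apply: fine_cvg; rewrite -momentE.
  exact: cvg_beta_integrand.
have E k : n.+1%:R * (\int[lam]_(t in `[0, b k]) beta_integrand n t) -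
   (n.+1%:R + gamma + 1) * (\int[lam]_(t in `[0, b k]) beta_integrand n.+1 t) = F (b k).
  have mb : measurable (`[0, b k]%classic : set (measurableTypeR R)) by [].
  have ib m : lam.-integrable `[0, b k] (EFin \o beta_integrand m).
    apply: integrableS (integrable_beta_integrand m) => //.
    by move=> t /=; rewrite !in_itv/= => /andP[-> h]/=; exact: le_lt_trans (b1 k).
  have iz m c : lam.-integrable `[0, b k] (EFin \o (fun t => c * beta_integrand m t)).
    by apply: eq_integrable (integrableZl _ c (ib m)).
  rewrite -!RintegralZl// -RintegralB//.
  by rewrite /Rintegral (FTC_lt1 (b0 k) (b1 k) dF cf)/= /F expr0n mul0r subr0.
have cvF : F (b k) @[k --> \oo] --> 0.
  apply: (@squeeze_cvgr _ _ _ _ (cst 0) (fun k => k.+1%:R^-1 `^ (gamma + 1))).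
  - apply: nearW => k; rewrite /F mulr_ge0 ?exprn_ge0 ?powR_ge0//=.
    by rewrite subKr ler_piMl ?powR_ge0// exprn_ile1// ltW.
  - exact: cvg_cst.
  - exact: cvg_harmonic_powR.
apply/eqP; rewrite eq_sym -subr_eq0; apply/eqP.
apply: (cvg_unique _ _ cvF) => //.
rewrite /=; under eq_fun => k do rewrite -E.
by apply: cvgB; apply: cvgM; [exact: cvg_cst|exact: cvm|exact: cvg_cst|exact: cvm].
Qed.

End moments.

(** * Rotations in complex notation *)

Section complex_components.
Context {R : realType}.
Implicit Types x y z : R[i].

Lemma complexReD x y : complex.Re (x + y) = complex.Re x + complex.Re y.
Proof. by case: x y => [? ?] [? ?]. Qed.
Lemma complexImD x y : complex.Im (x + y) = complex.Im x + complex.Im y.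
Proof. by case: x y => [? ?] [? ?]. Qed.
Lemma complexReM x y :
  complex.Re (x * y) = complex.Re x * complex.Re y - complex.Im x * complex.Im y.
Proof. by case: x y => [? ?] [? ?]. Qed.
Lemma complexImM x y :
  complex.Im (x * y) = complex.Re x * complex.Im y + complex.Im x * complex.Re y.
Proof. by case: x y => [? ?] [? ?]. Qed.
Lemma complexReJ x : complex.Re (x^*%C) = complex.Re x. Proof. by case: x. Qed.
Lemma complexImJ x : complex.Im (x^*%C) = - complex.Im x. Proof. by case: x. Qed.
Lemma eq_complexP x y :
  complex.Re x = complex.Re y -> complex.Im x = complex.Im y -> x = y.
Proof. by case: x y => [? ?] [? ?] /= -> ->. Qed.

Lemma normc_ge0 z : 0 <= Normc.normc z.
Proof. by case: z => a b; exact: sqrtr_ge0. Qed.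

Lemma sqr_normcE z : Normc.normc z ^+ 2 = complex.Re z ^+ 2 + complex.Im z ^+ 2.
Proof. by case: z => a b; rewrite sqr_sqrtr// addr_ge0// sqr_ge0. Qed.

Lemma complex_normrE z : `|z| = (Normc.normc z)%:C.
Proof. by case: z. Qed.

Lemma normr_lt1 z : (`|z| < 1) = (Normc.normc z < 1).
Proof. by rewrite complex_normrE ltcR. Qed.

Lemma normr_eq1 z : `|z| = 1 -> Normc.normc z = 1.
Proof. by rewrite complex_normrE => -[]. Qed.

Lemma sqr_normc_lt1 z : (Normc.normc z ^+ 2 < 1) = (Normc.normc z < 1).
Proof. by rewrite expr_lt1// normc_ge0. Qed.

Lemma ler_normc_Re z : `|complex.Re z| <= Normc.normc z.
Proof.
rewrite -ler_sqr ?nnegrE ?normc_ge0// real_normK ?num_real// sqr_normcE.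
by rewrite lerDl sqr_ge0.
Qed.

Lemma ler_normc_Im z : `|complex.Im z| <= Normc.normc z.
Proof.
rewrite -ler_sqr ?nnegrE ?normc_ge0// real_normK ?num_real// sqr_normcE.
by rewrite lerDr sqr_ge0.
Qed.

Lemma normcJ_real z : Normc.normc (z^*%C) = Normc.normc z.
Proof. by case: z => a b /=; rewrite sqrrN. Qed.

Lemma normcX z n : Normc.normc (z ^+ n) = Normc.normc z ^+ n.
Proof.
elim: n => [|n ih]; first by rewrite !expr0 Normc.normc1.
by rewrite !exprS Normc.normcM ih.
Qed.

Lemma normc_real (x : R) : Normc.normc (x%:C) = `|x|.
Proof. by rewrite /= expr0n addr0 sqrtr_sqr. Qed.

End complex_components.

Section rotation.
Context {R : realType}.
Local Notation lam := (@lebesgue_measure R).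
Local Notation mu := (@lebesgue2 R).
Local Notation R2 := (measurableTypeR R * measurableTypeR R)%type.
Local Notation D := (@point R @^-1` disk).

Lemma sqr_normc_point (p : R2) : Normc.normc (point p) ^+ 2 = sqnorm p.
Proof. by rewrite sqr_normcE. Qed.

Lemma point_disk (p : R2) : D p <-> sqnorm p < 1.
Proof. by rewrite /disk/= normr_lt1 -sqr_normc_lt1 sqr_normc_point. Qed.

Lemma preimage_diskE : D = sqnorm @^-1` `[0, 1[.
Proof.
apply/seteqP; split => p; first by move/point_disk; rewrite /= in_itv/= sqnorm_ge0.
by rewrite /= in_itv/= sqnorm_ge0/= => /point_disk.
Qed.

Lemma measurable_disk : measurable (D : set R2).
Proof. by rewrite preimage_diskE; exact: measurable_sqnorm_preimage. Qed.

Definition mul_point (eta : R[i]) : R2 -> R2 :=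
  rotation (complex.Re eta) (complex.Im eta).

Lemma point_mul eta p : point (mul_point eta p) = eta * point p.
Proof. by case: eta p => [? ?] [? ?]; apply: eq_complexP => //=; rewrite addrC. Qed.

Variable eta : R[i].
Hypothesis eta1 : Normc.normc eta = 1.

Lemma mul_point_preserving : measure_preserving (mul_point eta).
Proof. by apply: measure_preserving_rotation; rewrite -sqr_normcE eta1 expr1n. Qed.

Lemma sqnorm_mul p : sqnorm (mul_point eta p) = sqnorm p.
Proof. by rewrite -!sqr_normc_point point_mul Normc.normcM eta1 mul1r. Qed.

Lemma weight_mul gamma p : weight gamma (point (mul_point eta p)) = weight gamma (point p).
Proof. by rewrite /weight !sqr_normc_point sqnorm_mul. Qed.

Lemma preimage_mul_disk : mul_point eta @^-1` D = D.
Proof.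
by apply/seteqP; split => p /=; rewrite /disk/= !normr_lt1 point_mul Normc.normcM eta1 mul1r.
Qed.

Local Open Scope ereal_scope.

Let ge0_integral_mul_point (f : R2 -> \bar R) : measurable_fun D f -> (forall p, D p -> 0 <= f p) ->
  \int[mu]_(p in D) f (mul_point eta p) = \int[mu]_(p in D) f p.
Proof.
move=> mf f0; have [mr pr] := mul_point_preserving.
rewrite -[in LHS]preimage_mul_disk.
rewrite -(@ge0_integral_pushforward _ _ _ _ _ _ mr mu D f measurable_disk mf); last first.
  by move=> p; rewrite inE => /f0.
pose m : {measure set R2 -> \bar R} := pushforward mu (mul_point eta).
apply: (@eq_measure_integral _ _ _ _ _ (m mr)) => A mA _.
exact: pr.
Qed.

(** Positive and negative parts are handled separately, so the identity covers every measurable f,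
    in particular those built from unbounded Bergman functions. *)
Lemma integral_mul_point (f : R2 -> \bar R) : measurable_fun D f ->
  \int[mu]_(p in D) f (mul_point eta p) = \int[mu]_(p in D) f p.
Proof.
move=> mf; rewrite [LHS]integralE [RHS]integralE.
congr (_ - _).
- rewrite -[RHS](@ge0_integral_mul_point f^\+ (measurable_funepos mf)); last first.
    by move=> p _; exact: funepos_ge0.
  by apply: eq_integral => p _; rewrite ?funeposE ?funenegE.
- rewrite -[RHS](@ge0_integral_mul_point f^\- (measurable_funeneg mf)); last first.
    by move=> p _; exact: funeneg_ge0.
  by apply: eq_integral => p _; rewrite ?funeposE ?funenegE.
Qed.

End rotation.

(** * Integration against dA_gamma *)

Section integral_dA.
Context {R : realType}.
Local Notation lam := (@lebesgue_measure R).
Local Notation mu := (@lebesgue2 R).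
Local Notation R2 := (measurableTypeR R * measurableTypeR R)%type.
Local Notation D := (@point R @^-1` disk).
Implicit Types f g : R[i] -> R[i].

Variable gamma : R.
Hypothesis gamma_gt : -1 < gamma.

Let gamma1_gt0 : 0 < gamma + 1.
Proof. by rewrite -ltrBlDr sub0r. Qed.

Let wcst : R := pi^-1 * (gamma + 1).

Let wcst_gt0 : 0 < wcst.
Proof. by rewrite mulr_gt0 ?invr_gt0 ?pi_gt0. Qed.

Lemma weight_pointE (p : R2) :
  weight gamma (point p) = pi^-1 * (gamma + 1) * (1 - sqnorm p) `^ gamma.
Proof. by rewrite /weight sqr_normc_point. Qed.

Lemma weight_ge0 (z : R[i]) : 0 <= weight gamma z.
Proof. by rewrite mulr_ge0 ?powR_ge0// ltW. Qed.

Lemma measurable_weight : measurable_fun [set: R2] (weight gamma \o point).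
Proof.
rewrite (_ : _ \o _ = fun p => wcst * (1 - sqnorm p) `^ gamma); last first.
  by apply/funext => p; exact: weight_pointE.
apply: measurable_funM; first exact: measurable_cst.
apply: (measurableT_comp (measurable_powR gamma)).
by apply: measurable_funB; [exact: measurable_cst|exact: measurable_sqnorm].
Qed.

(** The squared Bergman norm of w^n, after the substitution t = |w|^2. *)
Definition weight_moment n : R := disk_area * (pi^-1 * (gamma + 1) * moment gamma n).

Lemma integral_sqnorm_weight n :
  (\int[mu]_(p in D) (sqnorm p ^+ n * weight gamma (point p))%:E = (weight_moment n)%:E)%E.
Proof.
have mb c : measurable_fun (`[0, 1[%classic : set (measurableTypeR R))
    (fun t => (c * beta_integrand gamma n t)%:E).
  apply/measurable_EFinP; apply: measurable_funM; first exact: measurable_cst.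
  by apply: measurable_funTS; exact: measurable_beta_integrand.
rewrite preimage_diskE.
transitivity (\int[mu]_(p in sqnorm @^-1` `[0%R, 1%R[)
    (wcst * beta_integrand gamma n (sqnorm p))%:E)%E.
  by apply: eq_integral => p _; congr EFin; rewrite weight_pointE /beta_integrand mulrCA.
rewrite (integral_radial (f := fun t => (wcst * beta_integrand gamma n t)%:E))//; last first.
  by move=> t /andP[t0 _]; rewrite lee_fin mulr_ge0 ?beta_integrand_ge0// ltW.
under eq_integral do rewrite EFinM.
rewrite ge0_integralZl_EFin//.
- by rewrite momentE.
- by move=> t /=; rewrite in_itv/= => /andP[t0 _]; rewrite lee_fin beta_integrand_ge0.
- by apply/measurable_EFinP; apply: measurable_funTS; exact: measurable_beta_integrand.
- exact: ltW.
Qed.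

(** For gamma < 0 the weight is unbounded near the circle, but its total mass [weight_moment 0] is
    finite, so it is an integrable dominating function up to the factor C. *)
Lemma integrable_mul_weight (h : R2 -> R) (C : R) : measurable_fun D h ->
  (forall p, D p -> `|h p| <= C) ->
  mu.-integrable D (EFin \o (fun p => h p * weight gamma (point p))).
Proof.
move=> mh hC; have mD := @measurable_disk R.
have mw : measurable_fun D (weight gamma \o point).
  by apply: measurable_funTS; exact: measurable_weight.
have iw : mu.-integrable D (EFin \o (fun p => C * weight gamma (point p))).
  have h0 : mu.-integrable D (EFin \o (weight gamma \o point)).
    apply/integrableP; split; first exact/measurable_EFinP.
    under eq_integral => p _ do rewrite /= ger0_norm ?weight_ge0//.
    rewrite (_ : \int[_]_(_ in _) _ = (weight_moment 0)%:E)%E ?ltry//.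
    rewrite -integral_sqnorm_weight; apply: eq_integral => p _.
    by rewrite expr0 mul1r.
  by apply: eq_integrable (integrableZl _ C h0).
apply: (le_integrable mD _ _ iw).
  by apply/measurable_EFinP; exact: measurable_funM.
move=> p Dp; rewrite /= lee_fin !normrM ler_wpM2r//.
by rewrite (le_trans (hC p Dp))// ler_norm.
Qed.

(** A class closed under sums, products and conjugation, all of whose members are integrable:
    linearity of [integral_dA] can then be used on truncated kernels without further integrability
    checks. *)
Definition bounded_measurable f : Prop :=
  [/\ measurable_fun D (fun p : R2 => complex.Re (f (point p))),
      measurable_fun D (fun p : R2 => complex.Im (f (point p))) &
      exists C : R, forall z, disk z -> Normc.normc (f z) <= C].

Lemma bounded_measurable_integrable f : bounded_measurable f ->
  mu.-integrable D (EFin \o (fun p => complex.Re (f (point p)) * weight gamma (point p))) /\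
  mu.-integrable D (EFin \o (fun p => complex.Im (f (point p)) * weight gamma (point p))).
Proof.
move=> [mr mi [C hC]]; split; apply: (@integrable_mul_weight _ C) => // p Dp.
  by apply: le_trans (ler_normc_Re _) _; exact: hC.
by apply: le_trans (ler_normc_Im _) _; exact: hC.
Qed.

Lemma bounded_measurable_cst (a : R[i]) : bounded_measurable (fun=> a).
Proof. by split; [exact: measurable_cst|exact: measurable_cst|exists (Normc.normc a)]. Qed.

Lemma bounded_measurable_id : bounded_measurable id.
Proof.
split.
- by apply: measurable_funTS; exact: measurable_fst.
- by apply: measurable_funTS; exact: measurable_snd.
- by exists 1 => z; rewrite /disk/= normr_lt1 => /ltW.
Qed.

Lemma bounded_measurableD f g : bounded_measurable f -> bounded_measurable g ->
  bounded_measurable (fun z => f z + g z).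
Proof.
move=> [mf1 mf2 [C hC]] [mg1 mg2 [C' hC']]; split.
- under eq_fun do rewrite complexReD; exact: measurable_funD.
- under eq_fun do rewrite complexImD; exact: measurable_funD.
- by exists (C + C') => z Dz; rewrite (le_trans (le_normcD _ _))// lerD ?hC ?hC'.
Qed.

Lemma bounded_measurableM f g : bounded_measurable f -> bounded_measurable g ->
  bounded_measurable (fun z => f z * g z).
Proof.
move=> [mf1 mf2 [C hC]] [mg1 mg2 [C' hC']]; split.
- under eq_fun do rewrite complexReM.
  by apply: measurable_funB; exact: measurable_funM.
- under eq_fun do rewrite complexImM.
  by apply: measurable_funD; exact: measurable_funM.
- exists (C * C') => z Dz; rewrite Normc.normcM ler_pM ?normc_ge0 ?hC ?hC'//.
Qed.

Lemma bounded_measurableJ f : bounded_measurable f ->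
  bounded_measurable (fun z => (f z)^*%C).
Proof.
move=> [mf1 mf2 [C hC]]; split.
- by under eq_fun do rewrite complexReJ.
- under eq_fun do rewrite complexImJ.
  exact: measurable_funN.
- by exists C => z Dz; rewrite normcJ_real hC.
Qed.

Lemma bounded_measurableX f n : bounded_measurable f ->
  bounded_measurable (fun z => f z ^+ n).
Proof.
move=> bf; elim: n => [|n ih]; first exact: bounded_measurable_cst.
by under eq_fun do rewrite exprS; exact: bounded_measurableM.
Qed.

Lemma bounded_measurable_sum (I : Type) (r : seq I) (F : I -> R[i] -> R[i]) :
  (forall i, bounded_measurable (F i)) ->
  bounded_measurable (fun z => \sum_(i <- r) F i z).
Proof.
move=> bF; elim: r => [|i r ih].
  by under eq_fun do rewrite big_nil; exact: bounded_measurable_cst.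
by under eq_fun do rewrite big_cons; exact: bounded_measurableD.
Qed.

Lemma eq_integral_dA f g : (forall z, disk z -> f z = g z) ->
  integral_dA gamma f = integral_dA gamma g.
Proof.
by move=> fg; rewrite /integral_dA; congr Complex; apply: eq_Rintegral => p;
  rewrite inE => Dp; rewrite fg.
Qed.

Lemma integral_dAD f g : bounded_measurable f -> bounded_measurable g ->
  integral_dA gamma (fun z => f z + g z) = integral_dA gamma f + integral_dA gamma g.
Proof.
move=> /bounded_measurable_integrable[f1 f2] /bounded_measurable_integrable[g1 g2].
have mD := @measurable_disk R.
apply: eq_complexP; rewrite ?complexReD ?complexImD /=.
  rewrite -RintegralD//; apply: eq_Rintegral => p _.
  by rewrite complexReD mulrDl.
rewrite -RintegralD//; apply: eq_Rintegral => p _.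
by rewrite complexImD mulrDl.
Qed.

Lemma integral_dAZ (a : R[i]) f : bounded_measurable f ->
  integral_dA gamma (fun z => a * f z) = a * integral_dA gamma f.
Proof.
move=> /bounded_measurable_integrable[f1 f2].
have mD := @measurable_disk R.
have iz (c : R) (h : R2 -> R) : mu.-integrable D (EFin \o h) ->
    mu.-integrable D (EFin \o (fun p => c * h p)).
  by move=> ih; apply: eq_integrable (integrableZl _ c ih).
apply: eq_complexP; rewrite ?complexReM ?complexImM /=.
  rewrite -!RintegralZl// -RintegralB//; try exact: iz.
  by apply: eq_Rintegral => p _; rewrite complexReM mulrBl !mulrA.
rewrite -!RintegralZl// -RintegralD//; try exact: iz.
by apply: eq_Rintegral => p _; rewrite complexImM mulrDl !mulrA.
Qed.

Lemma integral_dA_sum (I : Type) (r : seq I) (a : I -> R[i]) (F : I -> R[i] -> R[i]) :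
  (forall i, bounded_measurable (F i)) ->
  integral_dA gamma (fun z => \sum_(i <- r) a i * F i z) =
  \sum_(i <- r) a i * integral_dA gamma (F i).
Proof.
move=> bF; elim: r => [|i r ih].
  rewrite big_nil; under [in LHS]eq_fun do rewrite big_nil.
  apply: eq_complexP; rewrite /integral_dA/=;
    by under eq_Rintegral do rewrite mul0r; rewrite Rintegral_cst ?mul0r//; exact: measurable_disk.
rewrite big_cons; under [in LHS]eq_fun do rewrite big_cons.
rewrite integral_dAD ?ih ?integral_dAZ//.
  by apply: bounded_measurableM => //; exact: bounded_measurable_cst.
by apply: bounded_measurable_sum => j; apply: bounded_measurableM => //;
  exact: bounded_measurable_cst.
Qed.

Lemma integral_dA_rotation f (eta : R[i]) : Normc.normc eta = 1 ->
  measurable_fun D (fun p : R2 => complex.Re (f (point p))) ->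
  measurable_fun D (fun p : R2 => complex.Im (f (point p))) ->
  integral_dA gamma (fun z => f (eta * z)) = integral_dA gamma f.
Proof.
move=> eta1 m1 m2.
have mw : measurable_fun D (weight gamma \o point).
  by apply: measurable_funTS; exact: measurable_weight.
rewrite /integral_dA; congr Complex; rewrite /Rintegral; congr fine.
  rewrite -[RHS](integral_mul_point eta1); last first.
    by apply/measurable_EFinP; exact: measurable_funM.
  by apply: eq_integral => p _; rewrite weight_mul// point_mul.
rewrite -[RHS](integral_mul_point eta1); last first.
  by apply/measurable_EFinP; exact: measurable_funM.
by apply: eq_integral => p _; rewrite weight_mul// point_mul.
Qed.

Lemma bounded_measurable_monomial n m :
  bounded_measurable (fun w => w ^+ n * (w^*%C) ^+ m).
Proof.
apply: bounded_measurableM; apply: bounded_measurableX; first exact: bounded_measurable_id.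
by apply: bounded_measurableJ; exact: bounded_measurable_id.
Qed.

(** Rotating by zeta, or by its conjugate, multiplies w^n conj(w)^m with |n - m| = k by -1, so its
    integral equals its own opposite. The root exists because R[i] is algebraically closed. *)
Lemma unit_root_neg1 k : (0 < k)%N -> exists zeta : R[i],
  zeta ^+ k = -1 /\ Normc.normc zeta = 1.
Proof.
move=> k0; have [zeta] := @solve_monicpoly R[i] k (fun i => if i == 0%N then -1 else 0) k0.
case: k k0 => // k _; rewrite big_ord_recl/= big1 ?addr0 ?expr0 ?mulr1; last first.
  by move=> i _; rewrite mul0r.
move=> zk; exists zeta; split=> //.
have : Normc.normc zeta ^+ k.+1 = 1.
  by rewrite -normcX zk -[-1]/(- (1 : R[i])) normcN Normc.normc1.
by move=> /eqP; rewrite pexpr_eq1 ?normc_ge0// => /eqP.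
Qed.

Lemma integral_dA_monomial n m :
  integral_dA gamma (fun w => w ^+ n * (w^*%C) ^+ m) =
  if n == m then (weight_moment n)%:C else 0.
Proof.
have [<-|nm] := eqVneq n m.
  have E (p : R2) : point p ^+ n * ((point p)^*%C) ^+ n = (sqnorm p ^+ n)%:C.
    rewrite -exprMn (_ : (sqnorm p ^+ n)%:C = (sqnorm p)%:C ^+ n); last first.
      exact: (rmorphXn (real_complex R)).
    congr (_ ^+ n).
    apply: eq_complexP; rewrite ?complexReM ?complexImM complexReJ complexImJ/=.
      by rewrite mulrN opprK -!expr2.
    by rewrite mulrN mulrC addNr.
  apply: eq_complexP => /=.
    rewrite /Rintegral; under eq_integral => p _ do rewrite E/=.
    by rewrite integral_sqnorm_weight.
  under eq_Rintegral => p _ do rewrite E/= mul0r.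
  by rewrite Rintegral_cst ?mul0r//; exact: measurable_disk.
set I := integral_dA _ _.
have key (zeta : R[i]) : Normc.normc zeta = 1 -> I = zeta ^+ n * (zeta^*%C) ^+ m * I.
  move=> z1; have [m1 m2 _] := bounded_measurable_monomial n m.
  rewrite {1}/I -(integral_dA_rotation z1 m1 m2).
  rewrite -integral_dAZ; last exact: bounded_measurable_monomial.
  by apply: eq_integral_dA => w _; rewrite rmorphM !exprMn mulrACA.
have zz (zeta : R[i]) : Normc.normc zeta = 1 -> zeta * zeta^*%C = 1.
  move=> z1; apply: eq_complexP; rewrite ?complexReM ?complexImM complexReJ complexImJ/=.
    by rewrite mulrN opprK -!expr2 -sqr_normcE z1 expr1n.
  by rewrite mulrN mulrC addNr.
have I0 : I = - 1 * I -> I = 0.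
  move=> h; have : I + I = 0 by rewrite {1}h mulN1r addNr.
  by move/eqP; rewrite -mulr2n mulrn_eq0 => /eqP.
case: (ltngtP n m) nm => // nm _.
  have [|zeta [zk z1]] := @unit_root_neg1 (m - n); first by rewrite subn_gt0.
  (* For n < m the factor in [key] reduces to conj(zeta)^(m - n), so [key] is applied to the
     conjugate of the root. *)
  apply: I0; rewrite {1}(key zeta^*%C); last by rewrite normcJ_real.
  rewrite conjcK -(subnK (ltnW nm)) exprD [_ * zeta ^+ n]mulrC mulrA -exprMn.
  by rewrite [_ * zeta]mulrC zz// expr1n mul1r zk.
have [|zeta [zk z1]] := @unit_root_neg1 (n - m); first by rewrite subn_gt0.
apply: I0; rewrite {1}(key zeta)//.
congr (_ * _); rewrite -(subnK (ltnW nm)) exprD -mulrA -exprMn zz//.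
by rewrite expr1n mulr1.
Qed.

(** Orthogonality keeps only the diagonal of the double sum. Two multipliers are allowed because
    composition with a rotation alters the kernel in the first slot of the inner product only. *)
Lemma integral_dA_series N (c : nat -> R) (a b : R[i]) :
  integral_dA gamma (fun w => (\sum_(n < N) (c n)%:C * (a * w) ^+ n) *
                              (\sum_(m < N) (c m)%:C * (b * w) ^+ m)^*%C) =
  \sum_(n < N) (c n ^+ 2 * weight_moment n)%:C * (a * b^*%C) ^+ n.
Proof.
transitivity (integral_dA gamma (fun w => \sum_(n < N) ((c n)%:C * a ^+ n) *
    (\sum_(m < N) ((c m)%:C * (b^*%C) ^+ m) * (w ^+ n * (w^*%C) ^+ m)))).
  apply: eq_integral_dA => w _; rewrite mulr_suml; apply: eq_bigr => n _.
  rewrite rmorph_sum !mulr_sumr; apply: eq_bigr => m _.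
  rewrite rmorphM rmorphXn rmorphM/= !exprMn.
  by rewrite oppr0 complexr0; ring.
rewrite integral_dA_sum; last first.
  move=> n; apply: bounded_measurable_sum => m.
  by apply: bounded_measurableM; [exact: bounded_measurable_cst|exact: bounded_measurable_monomial].
apply: eq_bigr => n _; rewrite integral_dA_sum; last first.
  by move=> m; exact: bounded_measurable_monomial.
rewrite (bigD1 n)//= big1 ?addr0; last first.
  move=> m; rewrite eq_sym -val_eqE/= => /negbTE mn.
  by rewrite integral_dA_monomial mn mulr0.
have rM (x y : R) : (x * y)%:C = x%:C * y%:C by exact: (rmorphM (real_complex R)).
by rewrite integral_dA_monomial eqxx exprMn expr2 !rM; ring.
Qed.

End integral_dA.

(** * The principal branch of the power *)

Section principal_branch.
Context {R : realType}.
Implicit Types z : R[i].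

Lemma cos_sq_sin_sq (t : R) : cos t ^+ 2 + sin t ^+ 2 = 1.
Proof. by rewrite addrC sin2cos2 subrK. Qed.

(** Replaces the definition by [acos], whose case distinction hides smoothness across the positive
    real axis, by an expression that can be differentiated on the whole right half-plane. *)
Lemma carg_atan z : 0 < complex.Re z ->
  carg z = atan (complex.Im z / complex.Re z).
Proof.
move=> x0; set x := complex.Re z; set y := complex.Im z.
have X0 : 0 < x ^+ 2 + y ^+ 2 by rewrite ltr_pwDl ?exprn_gt0 ?sqr_ge0.
have nz : Normc.normc z = x * Num.sqrt (1 + (y / x) ^+ 2).
  apply/eqP; rewrite -(@eqrXn2 _ 2)// ?normc_ge0 ?mulr_ge0 ?sqrtr_ge0// ?(ltW x0)//.
  rewrite sqr_normcE exprMn sqr_sqrtr ?addr_ge0 ?sqr_ge0//.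
  by apply/eqP; rewrite -/x -/y; field; rewrite gt_eqF.
have cE : x / Normc.normc z = cos (atan (y / x)).
  rewrite cos_atan nz invfM mulrA divff ?mul1r//.
  by rewrite gt_eqF.
rewrite /carg -/x -/y cE; have [h1 h2] := (atan_gtNpi2 (y / x), atan_ltpi2 (y / x)).
have p0 := @pi_gt0 R.
case: ifPn => y0.
  have : 0 <= atan (y / x).
    by rewrite -atan0; apply: le_atan; rewrite divr_ge0// ltW.
  by move=> a0; rewrite cosK// in_itv/= a0/=; lra.
have : atan (y / x) <= 0.
  rewrite -[leRHS]atan0; apply: le_atan; rewrite -ltNge in y0.
  by rewrite mulr_le0_ge0 ?invr_ge0 ?ltW.
by move=> a0; rewrite cosKN ?opprK// a0 andbT; lra.
Qed.

Lemma normc_cpow z (s : R) : Normc.normc (cpow z s) = Normc.normc z `^ s.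
Proof.
rewrite /cpow Normc.normcM normc_real ger0_norm ?powR_ge0//.
by rewrite /= cos_sq_sin_sq sqrtr1 mulr1.
Qed.

(** The modulus power is written as a power s / 2 of the squared modulus, a polynomial in the
    coordinates, so that no square root has to be differentiated. *)
Lemma cpowE z (s : R) : 0 < complex.Re z ->
  cpow z s = ((complex.Re z ^+ 2 + complex.Im z ^+ 2) `^ (s / 2))%:C *
    (cos (s * atan (complex.Im z / complex.Re z)) +i*
     sin (s * atan (complex.Im z / complex.Re z))).
Proof.
move=> z0; rewrite /cpow carg_atan// -sqr_normcE -powR_mulrn ?normc_ge0//.
by rewrite -powRrM [2 * _]mulrC divfK.
Qed.

Lemma cpow_real (x s : R) : 0 < x -> cpow x%:C s = (x `^ s)%:C.
Proof.
move=> x0; rewrite /cpow carg_atan//= mul0r atan0 mulr0 cos0 sin0.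
by rewrite expr0n addr0 sqrtr_sqr gtr0_norm// complexr0 mulr1.
Qed.

End principal_branch.

(** * Derivatives of complex-valued functions of a real parameter *)

Section complex_derivative.
Context {R : realType}.
Implicit Types f g : R -> R[i].

Definition is_cderive f (t : R) (d : R[i]) : Prop :=
  is_derive t 1 (fun u => complex.Re (f u)) (complex.Re d) /\
  is_derive t 1 (fun u => complex.Im (f u)) (complex.Im d).

Lemma is_cderive_cst (a : R[i]) t : is_cderive (fun=> a) t 0.
Proof. by split; exact: is_derive_cst. Qed.

Lemma is_derive_mull (c t : R) : is_derive t 1 (fun u : R => c * u) c.
Proof. by have := is_deriveZ c (is_derive_id t (1:R)); rewrite /GRing.scale/= mulr1. Qed.

Lemma is_cderive_line (z : R[i]) t : is_cderive (fun u => u%:C * z) t z.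
Proof.
have h c := is_derive_mull c t.
split.
  rewrite (_ : (fun u => _) = (fun u => complex.Re z * u))//.
  by apply/funext => u; rewrite complexReM /= mul0r subr0 mulrC.
rewrite (_ : (fun u => _) = (fun u => complex.Im z * u))//.
by apply/funext => u; rewrite complexImM /= mul0r addr0 mulrC.
Qed.

Lemma is_cderiveD f g t a b : is_cderive f t a -> is_cderive g t b ->
  is_cderive (fun u => f u + g u) t (a + b).
Proof.
move=> [f1 f2] [g1 g2]; split.
  by under eq_fun do rewrite complexReD; rewrite complexReD; exact: is_deriveD.
by under eq_fun do rewrite complexImD; rewrite complexImD; exact: is_deriveD.
Qed.

Lemma is_cderiveM f g t a b : is_cderive f t a -> is_cderive g t b ->
  is_cderive (fun u => f u * g u) t (a * g t + f t * b).
Proof.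
move=> [f1 f2] [g1 g2]; split.
  under eq_fun do rewrite complexReM.
  apply: (is_derive_eq (is_deriveB (is_deriveM f1 g1) (is_deriveM f2 g2))).
  by rewrite complexReD !complexReM /GRing.scale/=; ring.
under eq_fun do rewrite complexImM.
apply: (is_derive_eq (is_deriveD (is_deriveM f1 g2) (is_deriveM f2 g1))).
by rewrite complexImD !complexImM /GRing.scale/=; ring.
Qed.

Lemma is_cderiveX (z : R[i]) n t :
  is_cderive (fun u => (u%:C * z) ^+ n) t (n%:R * z * (t%:C * z) ^+ n.-1).
Proof.
elim: n => [|n ih]; first by rewrite !mul0r; exact: is_cderive_cst.
under eq_fun do rewrite exprS.
have := is_cderiveM (is_cderive_line z t) ih.
rewrite (_ : _ + _ = n.+1%:R * z * (t%:C * z) ^+ n.+1.-1)//=.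
case: n {ih} => [|n]; first by rewrite !mul0r mulr0 addr0 expr0 mul1r mulr1.
by rewrite exprS -[n.+2%:R]natr1; ring.
Qed.

Lemma is_cderive_cpow (z : R[i]) (s t : R) : 0 < complex.Re (1 - t%:C * z) ->
  is_cderive (fun u => cpow (1 - u%:C * z) s) t
    (- (s%:C * z / (1 - t%:C * z)) * cpow (1 - t%:C * z) s).
Proof.
pose a := complex.Re z; pose b := complex.Im z.
pose x (u : R) := 1 - a * u; pose y (u : R) := - (b * u).
have xE u : complex.Re (1 - u%:C * z) = x u.
  by rewrite /x /a; case: (z) => ? ? /=; rewrite mul0r subr0 mulrC.
have yE u : complex.Im (1 - u%:C * z) = y u.
  by rewrite /y /b; case: (z) => ? ? /=; rewrite mul0r addr0 add0r mulrC.
rewrite xE => x0.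
have dx : is_derive t 1 x (- a).
  rewrite -[- a]sub0r.
  exact: (is_deriveB (is_derive_cst (1:R) t 1) (is_derive_mull a t)).
have dy : is_derive t 1 y (- b) by exact: (is_deriveN (is_derive_mull b t)).
have X0 : 0 < x t ^+ 2 + y t ^+ 2 by rewrite ltr_pwDl ?exprn_gt0 ?sqr_ge0.
have dX : is_derive t 1 (fun u => x u ^+ 2 + y u ^+ 2) (- (2 * (a * x t + b * y t))).
  have := is_deriveD (is_deriveX 2 dx) (is_deriveX 2 dy).
  move=> /is_derive_eq; apply; rewrite /GRing.scale/= !expr1; ring.
have dM := @is_derive1_comp R (fun v => v `^ (s / 2)) (fun u => x u ^+ 2 + y u ^+ 2) t _ _
  (is_derive1_powR (s / 2) X0) dX.
have dth : is_derive t 1 (fun u => s * atan (y u / x u))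
    (s * ((a * y t - b * x t) / (x t ^+ 2 + y t ^+ 2))).
  have dq := is_deriveM dy (is_deriveV (lt0r_neq0 x0) dx).
  have := is_deriveZ s (@is_derive1_comp R atan (fun u => y u / x u) t _ _
    (is_derive1_atan (y t / x t)) dq).
  move=> /is_derive_eq; apply; rewrite /GRing.scale/=; congr (s * _).
  by field; rewrite !gt_eqF.
have dc := @is_derive1_comp R cos (fun u => s * atan (y u / x u)) t _ _ (is_derive_cos _) dth.
have ds := @is_derive1_comp R sin (fun u => s * atan (y u / x u)) t _ _ (is_derive_sin _) dth.
have cE u : 0 < x u -> cpow (1 - u%:C * z) s =
  ((x u ^+ 2 + y u ^+ 2) `^ (s / 2))%:C *
  (cos (s * atan (y u / x u)) +i* sin (s * atan (y u / x u))).
  by move=> xu; rewrite cpowE ?xE ?yE.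
(* [cE] is available only where x is positive, so the derivative of the explicit formula is
   transferred through equality near t. *)
have xnear : \near t, 0 < x t.
  have [dxt _] := dx; have ct : {for t, continuous x}.
    exact/differentiable_continuous/derivable1_diffP.
  exact: (cvgr_gt _ ct).
(* The logarithmic derivative of m exp(i theta) has real part m' / m and imaginary part theta'; here
   both are assembled into - s z / (1 - t z). *)
have lamE : - (s%:C * z / (1 - t%:C * z)) =
   (- (s * (a * x t + b * y t) / (x t ^+ 2 + y t ^+ 2))) +i*
   (s * ((a * y t - b * x t) / (x t ^+ 2 + y t ^+ 2))).
  have nz : 1 - t%:C * z != 0.
    by apply/eqP => /(congr1 (@complex.Re R)); rewrite xE => /eqP; rewrite gt_eqF.
  apply: (mulIf nz); rewrite mulNr divfK//.
  have zr : complex.Re (- (s%:C * z)) = - (s * a).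
    by rewrite /a; case: (z) => ? ? /=; rewrite mul0r subr0.
  have zi : complex.Im (- (s%:C * z)) = - (s * b).
    by rewrite /b; case: (z) => ? ? /=; rewrite mul0r addr0.
  apply: eq_complexP; rewrite ?complexReM ?complexImM xE yE ?zr ?zi/=;
    by field; rewrite gt_eqF.
have powE : (x t ^+ 2 + y t ^+ 2) `^ (s / 2 - 1) =
    (x t ^+ 2 + y t ^+ 2) `^ (s / 2) / (x t ^+ 2 + y t ^+ 2).
  by rewrite powRB ?(powRr1 (ltW X0))// (gt_eqF X0) implybT.
rewrite lamE (cE _ x0); split.
  apply: (near_eq_is_derive (f := fun u =>
    (x u ^+ 2 + y u ^+ 2) `^ (s / 2) * cos (s * atan (y u / x u)))).
    by near=> u; rewrite cE ?complexReM/= ?mul0r ?subr0//; near: u.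
  apply: (is_derive_eq (is_deriveM dM dc)).
  rewrite powE !complexReM ?complexImM /GRing.scale/= !mul0r subr0 addr0.
  by field; rewrite gt_eqF.
apply: (near_eq_is_derive (f := fun u =>
    (x u ^+ 2 + y u ^+ 2) `^ (s / 2) * sin (s * atan (y u / x u)))).
  by near=> u; rewrite cE ?complexImM/= ?mul0r ?addr0//; near: u.
apply: (is_derive_eq (is_deriveM dM ds)).
rewrite powE !complexImM !complexReM /GRing.scale/= !mul0r subr0 addr0.
by field; rewrite gt_eqF.
Unshelve. all: by end_near. Qed.

End complex_derivative.

(** * The binomial series *)

Section binomial_series.
Context {R : realType}.
Variable s : R.
Hypothesis s_gt0 : 0 < s.

(** s (s + 1) ... (s + n - 1) / n!, the Taylor coefficient of (1 - z)^(- s). *)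
Definition binom_coef (n : nat) : R := \prod_(i < n) ((s + i%:R) / i.+1%:R).

Lemma binom_coef0 : binom_coef 0 = 1. Proof. exact: big_ord0. Qed.

Lemma binom_coefS n : binom_coef n.+1 * n.+1%:R = binom_coef n * (s + n%:R).
Proof. by rewrite /binom_coef big_ord_recr/= -mulrA divfK ?pnatr_eq0. Qed.

Lemma binom_coef_gt0 n : 0 < binom_coef n.
Proof. by apply: prodr_gt0 => i _; rewrite divr_gt0 ?ltr0n// ltr_wpDr. Qed.

Definition binom_psum (N : nat) (z : R[i]) : R[i] :=
  \sum_(n < N) (binom_coef n)%:C * z ^+ n.

(** Ratio test; up to a constant this is the error in [binom_psum_cpow]. The index is shifted by one
    to clear the predecessor in the exponent. *)
Lemma cvg_binom_term (rho : R) : 0 <= rho -> rho < 1 ->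
  n%:R * binom_coef n * rho ^+ n.-1 @[n --> \oo] --> 0.
Proof.
move=> r0 r1; pose w n : R := binom_coef n.+1 * n.+1%:R * rho ^+ n.
rewrite -(cvg_shiftn 1) (_ : [sequence _]_n = w); last first.
  by apply/funext => n; rewrite /w /mk_sequence addn1/= [_%:R * _]mulrC.
have w0 n : 0 <= w n by rewrite !mulr_ge0 ?exprn_ge0 ?(ltW (binom_coef_gt0 _)).
pose q := (1 + rho) / 2.
have q1 : q < 1 by rewrite /q; lra.
have q0 : 0 <= q by rewrite /q; lra.
have qr : 0 < q - rho by rewrite /q; lra.
(* The ratio w (n + 1) / w n is rho (s + n + 1) / (n + 1); it is at most q, the midpoint of rho and
   1, as soon as s rho <= (n + 1) (q - rho). *)
pose n0 := Num.bound (s * rho / (q - rho)).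
have wS n : (n0 <= n)%N -> w n.+1 <= q * w n.
  move=> n0n; rewrite /w [binom_coef n.+2 * _]binom_coefS exprS.
  have h : (s + n.+1%:R) * rho <= q * n.+1%:R.
    have := archi_boundP (divr_ge0 (mulr_ge0 (ltW s_gt0) r0) (ltW qr)).
    rewrite ltr_pdivrMr// -/n0 => h1.
    have h2 : n0%:R * (q - rho) <= n.+1%:R * (q - rho).
      by rewrite ler_wpM2r ?(ltW qr)// ler_nat (leq_trans n0n).
    have -> : (s + n.+1%:R) * rho = s * rho + n.+1%:R * rho by ring.
    by move: h1 h2; lra.
  have -> : binom_coef n.+1 * (s + n.+1%:R) * (rho * rho ^+ n) =
     (binom_coef n.+1 * rho ^+ n) * ((s + n.+1%:R) * rho) by ring.
  have -> : q * (binom_coef n.+1 * n.+1%:R * rho ^+ n) =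
     (binom_coef n.+1 * rho ^+ n) * (q * n.+1%:R) by ring.
  by rewrite ler_wpM2l// mulr_ge0 ?exprn_ge0 ?(ltW (binom_coef_gt0 _)).
have wq k : w (k + n0)%N <= geometric (w n0) q k.
  elim: k => [|k ih]; first by rewrite add0n /= expr0 mulr1.
  rewrite addSn (le_trans (wS _ (leq_addl _ _)))//.
  have -> : geometric (w n0) q k.+1 = q * geometric (w n0) q k.
    by rewrite /geometric/= exprS mulrCA.
  exact: ler_wpM2l.
rewrite -(cvg_shiftn n0).
apply: (@squeeze_cvgr _ _ _ _ (cst 0) (geometric (w n0) q)).
- by apply: nearW => k; rewrite w0 wq.
- exact: cvg_cst.
- by apply: cvg_geometric; rewrite ger0_norm.
Qed.

(** The termwise derivative of [binom_psum]; at n = 0 the factor n makes the truncated exponent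
    harmless. *)
Definition binom_dsum (N : nat) (u : R[i]) : R[i] :=
  \sum_(n < N) (binom_coef n)%:C * (n%:R * u ^+ n.-1).

(** The full series solves (1 - u) P' = s P. By the recurrence of the coefficients the terms
    telescope, and the partial sum misses this equation by its last term only. *)
Lemma binom_dsumE N u : (1 - u) * binom_dsum N u =
  s%:C * binom_psum N u - N%:R * (binom_coef N)%:C * u ^+ N.-1.
Proof.
have recC n : (binom_coef n.+1)%:C * n.+1%:R = (binom_coef n)%:C * (s%:C + n%:R) :> R[i].
  have /(congr1 (real_complex R)) := binom_coefS n.
  by rewrite !rmorphM rmorphD !rmorph_nat.
rewrite /binom_dsum /binom_psum; elim: N => [|N ih].
  by rewrite !big_ord0 !mul0r !mulr0 subrr.
rewrite !big_ord_recr/= !mulrDr ih [N.+1%:R * _]mulrC recC.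
case: N {ih} => [|N]; first by rewrite big_ord0 expr0; ring.
by rewrite exprS /=; ring.
Qed.

Lemma is_cderive_binom_psum N (z : R[i]) t :
  is_cderive (fun u => binom_psum N (u%:C * z)) t (z * binom_dsum N (t%:C * z)).
Proof.
rewrite /binom_psum /binom_dsum; elim: N => [|N ih].
  under eq_fun do rewrite big_ord0.
  by rewrite big_ord0 mulr0; exact: is_cderive_cst.
under eq_fun do rewrite big_ord_recr/=.
rewrite big_ord_recr/= mulrDr; apply: is_cderiveD => //.
have := is_cderiveM (is_cderive_cst (binom_coef N)%:C t) (is_cderiveX z N t).
by rewrite mul0r add0r; congr is_cderive; ring.
Qed.

Variable z : R[i].
Hypothesis z_lt1 : Normc.normc z < 1.

Let rho := Normc.normc z.

Let rho_ge0 : 0 <= rho. Proof. exact: normc_ge0. Qed.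

Lemma ler_normc_1B (t : R) : 0 <= t <= 1 ->
  1 - rho <= complex.Re (1 - t%:C * z) /\ 1 - rho <= Normc.normc (1 - t%:C * z) <= 2.
Proof.
move=> /andP[t0 t1].
have nt : Normc.normc (t%:C * z) <= rho.
  by rewrite Normc.normcM normc_real ger0_norm// ler_piMl.
have re : 1 - rho <= complex.Re (1 - t%:C * z).
  have := ler_normc_Re (t%:C * z); rewrite ler_norml => /andP[_ h].
  have -> : complex.Re (1 - t%:C * z) = 1 - complex.Re (t%:C * z).
    by case: (t%:C * z).
  by rewrite lerD2l lerN2 (le_trans h).
split=> //; apply/andP; split.
  by rewrite (le_trans re)// (le_trans (ler_norm _))// ler_normc_Re.
apply: le_trans (le_normcD _ _) _; rewrite normcN Normc.normc1.
by rewrite -[2]/(1 + 1 : R) lerD2l (le_trans nt)// ltW.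
Qed.

(** Bounds the derivative [d] in the next proof: along the segment |1 - t z| is at most 2, used in
    the power, and at least 1 - rho, used in the denominator, while |z| < 1. *)
Let err N : R := 2 `^ s / (1 - rho) * (N%:R * binom_coef N * rho ^+ N.-1).

(** The product of the partial sum and (1 - t z)^s equals 1 at t = 0, and by [binom_dsumE] only the
    defect term survives in its derivative. The mean value theorem is applied to real and imaginary
    parts separately. The index N + 1 makes the sum nonempty, as the value at 0 requires. *)
Lemma binom_psum_cpow N :
  `|complex.Re (binom_psum N.+1 z * cpow (1 - z) s) - 1| <= err N.+1 /\
  `|complex.Im (binom_psum N.+1 z * cpow (1 - z) s)| <= err N.+1.
Proof.
pose f t := binom_psum N.+1 (t%:C * z) * cpow (1 - t%:C * z) s.
pose d t := - (z / (1 - t%:C * z) * cpow (1 - t%:C * z) s *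
   (N.+1%:R * (binom_coef N.+1)%:C * (t%:C * z) ^+ N)).
have df t : 0 <= t <= 1 -> is_cderive f t (d t).
  move=> t01; have [re0 _] := ler_normc_1B t01.
  have re : 0 < complex.Re (1 - t%:C * z) by rewrite (lt_le_trans _ re0)// subr_gt0.
  have nz : 1 - t%:C * z != 0.
    by apply/eqP => h; move: re; rewrite h ltxx.
  have := is_cderiveM (is_cderive_binom_psum N.+1 z t) (is_cderive_cpow s re).
  congr is_cderive; rewrite /d.
  have := binom_dsumE N.+1 (t%:C * z) => /= E.
  have {}E : binom_dsum N.+1 (t%:C * z) = (s%:C * binom_psum N.+1 (t%:C * z) -
     N.+1%:R * (binom_coef N.+1)%:C * (t%:C * z) ^+ N) / (1 - t%:C * z).
    by rewrite -E mulrAC divff// mul1r.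
  by rewrite E; field.
have dbound t : 0 <= t <= 1 -> Normc.normc (d t) <= err N.+1.
  move=> t01; have [_ /andP[n1 n2]] := ler_normc_1B t01.
  have r1 : 0 < 1 - rho by rewrite subr_gt0.
  have nB : 0 < Normc.normc (1 - t%:C * z) by exact: lt_le_trans n1.
  have normc_nat n : Normc.normc (n%:R : R[i]) = n%:R.
    by rewrite -(rmorph_nat (real_complex R)) normc_real ger0_norm.
  rewrite /d normcN; have := normc_cpow (1 - t%:C * z) s.
  move: (cpow (1 - t%:C * z) s) => P nP.
  rewrite !Normc.normcM Normc.normcV nP normc_nat normc_real.
  rewrite (ger0_norm (ltW (binom_coef_gt0 _))) normcX Normc.normcM normc_real.
  have /andP[t0 t1] := t01; rewrite (ger0_norm t0) /err.
  rewrite ler_pM ?mulr_ge0 ?exprn_ge0 ?powR_ge0 ?invr_ge0 ?normc_ge0 ?(ltW (binom_coef_gt0 _))//.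
  - exact: mulr_ge0 (normc_ge0 z).
  - rewrite mulrC ler_pM ?mulr_ge0 ?powR_ge0 ?invr_ge0 ?normc_ge0//.
      by rewrite ge0_ler_powR ?nnegrE ?normc_ge0// ltW.
    rewrite -[leRHS]mul1r ler_pM ?invr_ge0 ?normc_ge0 ?(ltW z_lt1)//.
    by rewrite lef_pV2 ?posrE.
  - rewrite ler_wpM2l ?mulr_ge0 ?(ltW (binom_coef_gt0 _))//=.
    by rewrite lerXn2r ?nnegrE ?mulr_ge0 ?normc_ge0// ler_piMl.
have f1 : f 1 = binom_psum N.+1 z * cpow (1 - z) s by rewrite /f !mul1r.
have f0 : f 0 = 1.
  rewrite /f !mul0r subr0 /binom_psum big_ord_recl/= big1 ?addr0; last first.
    by move=> i _; rewrite exprS mul0r mulr0.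
  by rewrite expr0 binom_coef0 mulr1 mul1r -[1]/(1%:C) cpow_real// powR1.
have mvt (g dg : R -> R) : (forall t : R, 0 <= t <= 1 -> is_derive t 1 g (dg t)) ->
    (forall t : R, 0 <= t <= 1 -> `|dg t| <= err N.+1) -> `|g 1 - g 0| <= err N.+1.
  move=> dgt db; have [||c] := @MVT_segment R g dg 0 1 ler01.
  - by move=> t; rewrite in_itv/= => /andP[? ?]; apply: dgt; rewrite !ltW.
  - apply: derivable_within_continuous => t; rewrite in_itv/= => t01.
    by have [] := dgt t t01.
  - by rewrite in_itv/= => c01 ->; rewrite subr0 mulr1 db.
split.
  have := mvt (fun t => complex.Re (f t)) (fun t => complex.Re (d t)).
  rewrite f1 f0; apply; first by move=> t /df[].
  by move=> t /dbound; apply: le_trans; exact: ler_normc_Re.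
have := mvt (fun t => complex.Im (f t)) (fun t => complex.Im (d t)).
rewrite f1 f0 subr0; apply; first by move=> t /df[].
by move=> t /dbound; apply: le_trans; exact: ler_normc_Im.
Qed.

Lemma cvg_binom_psum :
  complex.Re (binom_psum N z) @[N --> \oo] --> complex.Re (cpow (1 - z) s)^-1 /\
  complex.Im (binom_psum N z) @[N --> \oo] --> complex.Im (cpow (1 - z) s)^-1.
Proof.
have err0 : err N.+1 @[N --> \oo] --> 0.
  have h : err N @[N --> \oo] --> 0.
    rewrite -[X in _ --> X](mulr0 (2 `^ s / (1 - rho))).
    by apply: cvgM; [exact: cvg_cst|exact: cvg_binom_term].
  by rewrite (cvg_shiftS err).
have c1 : complex.Re (binom_psum N.+1 z * cpow (1 - z) s) @[N --> \oo] --> (1 : R).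
  apply: (@squeeze_cvgr _ _ _ _ (fun N => 1 - err N.+1) (fun N => 1 + err N.+1)).
  - apply: nearW => N; have [+ _] := binom_psum_cpow N.
    by rewrite ler_norml => /andP[h1 h2]; apply/andP; split; lra.
  - by rewrite -[X in _ --> X]subr0; apply: cvgB => //; exact: cvg_cst.
  - by rewrite -[X in _ --> X]addr0; apply: cvgD => //; exact: cvg_cst.
have c2 : complex.Im (binom_psum N.+1 z * cpow (1 - z) s) @[N --> \oo] --> 0.
  apply: (@squeeze_cvgr _ _ _ _ (fun N => - err N.+1) (fun N => err N.+1)) => //.
  - apply: nearW => N; have [_] := binom_psum_cpow N.
    by rewrite ler_norml.
  - by rewrite -[X in _ --> X]oppr0; exact: cvgN.
have P0 : cpow (1 - z) s != 0.
  apply/eqP => /(congr1 (@Normc.normc R)); rewrite normc_cpow Normc.normc0.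
  have [|_ /andP[n1 _]] := @ler_normc_1B 1; first by rewrite ler01 lexx.
  by move/eqP; rewrite gt_eqF// powR_gt0// -[z]mul1r (lt_le_trans _ n1)// subr_gt0.
set Q := (cpow (1 - z) s)^-1.
have E N : binom_psum N.+1 z = (binom_psum N.+1 z * cpow (1 - z) s) * Q.
  by rewrite mulfK.
split.
  rewrite -[X in _ --> X]subr0 -[X in X - _]mul1r -[X in _ - X](mul0r (complex.Im Q)).
  have h : complex.Re (binom_psum N.+1 z) @[N --> \oo] -->
      1 * complex.Re Q - 0 * complex.Im Q.
    under eq_fun do rewrite E complexReM.
    by apply: cvgB; apply: cvgM => //; exact: cvg_cst.
  by move: h; rewrite (cvg_shiftS (fun N => complex.Re (binom_psum N z))).
rewrite -[X in _ --> X]addr0 -[X in X + _]mul1r -[X in _ + X](mul0r (complex.Re Q)).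
have h : complex.Im (binom_psum N.+1 z) @[N --> \oo] -->
    1 * complex.Im Q + 0 * complex.Re Q.
  under eq_fun do rewrite E complexImM.
  by apply: cvgD; apply: cvgM => //; exact: cvg_cst.
by move: h; rewrite (cvg_shiftS (fun N => complex.Im (binom_psum N z))).
Qed.

End binomial_series.

(** * The Berezin transform *)

Section bounded_convergence.
Context {R : realType}.
Local Notation lam := (@lebesgue_measure R).
Local Notation mu := (@lebesgue2 R).
Local Notation R2 := (measurableTypeR R * measurableTypeR R)%type.
Local Notation D := (@point R @^-1` disk).
Variable gamma : R.
Hypothesis gamma_gt : -1 < gamma.

(** Dominated convergence, with C times the weight as dominating function. *)
Lemma Rintegral_bounded_cvg (f_ : nat -> R2 -> R) (f : R2 -> R) (C : R) :
  (forall n, measurable_fun D (f_ n)) -> (forall n p, D p -> `|f_ n p| <= C) ->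
  (forall p, D p -> f_ n p @[n --> \oo] --> f p) ->
  \int[mu]_(p in D) (f_ n p * weight gamma (point p)) @[n --> \oo] -->
  \int[mu]_(p in D) (f p * weight gamma (point p)).
Proof.
move=> mf fC ff; have mD := @measurable_disk R.
have mw : measurable_fun D (weight gamma \o point).
  by apply: measurable_funTS; exact: measurable_weight.
have mlim : measurable_fun D f by exact: (measurable_fun_cvg mf).
have fCl p : D p -> `|f p| <= C.
  move=> Dp; apply: (@closed_cvg _ _ \oo _ (f_ ^~ p) [set y | `|y| <= C]) (ff p Dp).
    have -> : [set y : R | `|y| <= C] = Num.norm @^-1` [set y | y <= C] by [].
    by apply: closed_comp; [move=> y _; exact: norm_continuous|exact: closed_le].
  by apply: nearW => n; exact: fC.
have fin : (\int[mu]_(p in D) (f p * weight gamma (point p))%:E)%E \is a fin_num.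
  by apply: integrable_fin_num => //; exact: (integrable_mul_weight gamma_gt mlim fCl).
apply: fine_cvg; rewrite /Rintegral fineK//.
have iC : mu.-integrable D (EFin \o (fun p => C * weight gamma (point p))).
  apply: (@integrable_mul_weight _ _ gamma_gt (fun=> C) `|C|) => //.
have ifw n : measurable_fun D (fun p => (f_ n p * weight gamma (point p))%:E).
  by apply/measurable_EFinP; exact: measurable_funM.
have [||_ _ h] := @dominated_convergence _ _ _ mu D mD
  (fun n p => (f_ n p * weight gamma (point p))%:E)
  (fun p => (f p * weight gamma (point p))%:E)
  (fun p => (C * weight gamma (point p))%:E)
  ifw (proj2 (measurable_EFinP _ _) (measurable_funM mlim mw)) _ iC _; last exact: h.
- apply/aeW => p Dp; apply: cvg_EFin; first exact: nearW.
  by apply: cvgM; [exact: ff|exact: cvg_cst].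
- apply/aeW => p n Dp; rewrite lee_fin normrM (ger0_norm (weight_ge0 gamma_gt _)).
  by rewrite ler_wpM2r ?weight_ge0// fC.
Qed.

Implicit Types F : nat -> R[i] -> R[i].

(** Componentwise, to match [integral_dA] and [cvg_binom_psum]. *)
Definition ccvg (u : nat -> R[i]) (l : R[i]) : Prop :=
  complex.Re (u n) @[n --> \oo] --> complex.Re l /\
  complex.Im (u n) @[n --> \oo] --> complex.Im l.

Lemma ccvg_unique u l l' : ccvg u l -> ccvg u l' -> l = l'.
Proof.
by move=> [r1 i1] [r2 i2]; apply: eq_complexP;
  [exact: (cvg_unique _ r1 r2)|exact: (cvg_unique _ i1 i2)].
Qed.

Lemma ccvgM u v l l' : ccvg u l -> ccvg v l' -> ccvg (fun n => u n * v n) (l * l').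
Proof.
move=> [r1 i1] [r2 i2]; split.
  under eq_fun do rewrite complexReM; rewrite complexReM.
  by apply: cvgB; exact: cvgM.
under eq_fun do rewrite complexImM; rewrite complexImM.
by apply: cvgD; exact: cvgM.
Qed.

Lemma ccvgJ u l : ccvg u l -> ccvg (fun n => (u n)^*%C) (l^*%C).
Proof.
move=> [r1 i1]; split.
  by under eq_fun do rewrite complexReJ; rewrite complexReJ.
by under eq_fun do rewrite complexImJ; rewrite complexImJ; exact: cvgN.
Qed.

Lemma ccvg_cst l : ccvg (fun=> l) l.
Proof. by split; exact: cvg_cst. Qed.

Lemma integral_dA_cvg F G (C : R) : (forall n, bounded_measurable (F n)) ->
  (forall n z, disk z -> Normc.normc (F n z) <= C) ->
  (forall z, disk z -> ccvg (F ^~ z) (G z)) ->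
  ccvg (fun n => integral_dA gamma (F n)) (integral_dA gamma G).
Proof.
move=> bF FC FG; split; rewrite /integral_dA/=.
  apply: (@Rintegral_bounded_cvg _ _ C).
  - by move=> n; have [] := bF n.
  - by move=> n p Dp; rewrite (le_trans (ler_normc_Re _))// FC.
  - by move=> p Dp; have [] := FG _ Dp.
apply: (@Rintegral_bounded_cvg _ _ C).
- by move=> n; have [] := bF n.
- by move=> n p Dp; rewrite (le_trans (ler_normc_Im _))// FC.
- by move=> p Dp; have [] := FG _ Dp.
Qed.

End bounded_convergence.

(** * Closed form of the Berezin transform of a rotation *)

Section berezin_formula.
Context {R : realType}.
Variable gamma : R.
Hypothesis gamma_gt : -1 < gamma.

Let s := gamma + 2.

Let s_gt0 : 0 < s. Proof. by rewrite /s; move: gamma_gt; lra. Qed.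

(** As s + n = (n + 1) + gamma + 1, the ratio of consecutive coefficients is inverse to that of
    consecutive moments. Hence the c_n^2 of [integral_dA_series] reduces to c_n, and the diagonal
    sum is again a binomial series. *)
Lemma weight_moment_binom n :
  binom_coef s n * weight_moment gamma n = weight_moment gamma 0.
Proof.
elim: n => [|n <-]; first by rewrite binom_coef0 mul1r.
rewrite /weight_moment; have hr := moment_rec gamma_gt n.
have hb := binom_coefS s n.
have n0 : n.+1%:R != 0 :> R by rewrite pnatr_eq0.
have {}hb : binom_coef s n.+1 = binom_coef s n * (s + n%:R) / n.+1%:R by rewrite -hb mulfK.
have e : s + n%:R = n.+1%:R + gamma + 1 by rewrite /s -natr1; ring.
have {}hr : moment gamma n = (s + n%:R) * moment gamma n.+1 / n.+1%:R.
  by rewrite e hr mulrC mulKf.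
by rewrite hb hr; ring.
Qed.

Lemma weight_moment0 : weight_moment gamma 0 = disk_area / pi.
Proof.
rewrite /weight_moment moment0// mulfK// gt_eqF//.
by move: gamma_gt; lra.
Qed.

(** Positive coefficients give |P_N(u)| <= P_N(rho), and P_N(rho) is bounded because it
    converges. *)
Lemma binom_psum_bounded (rho : R) : 0 <= rho -> rho < 1 ->
  exists C : R, forall N u, Normc.normc u <= rho -> Normc.normc (binom_psum s N u) <= C.
Proof.
move=> r0 r1; have nr : Normc.normc (rho%:C) < 1 by rewrite normc_real ger0_norm.
have [cr _] := cvg_binom_psum s_gt0 nr.
have [M [Mreal hM]] : bounded_fun (fun N => complex.Re (binom_psum s N rho%:C)).
  by apply: cvg_seq_bounded; apply/cvg_ex; eexists; exact: cr.
(* [bounded_fun] provides the bound only for numbers strictly above M. *)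
exists (M + 1) => N u nu.
have := hM (M + 1) (ltr_pwDr ltr01 (lexx _)) N I => /= h; apply: le_trans h.
rewrite (le_trans _ (ler_norm _))// /binom_psum.
elim: N => [|N ih]; first by rewrite !big_ord0 Normc.normc0.
rewrite !big_ord_recr/= complexReD (le_trans (le_normcD _ _))// lerD//.
rewrite Normc.normcM normc_real (ger0_norm (ltW (binom_coef_gt0 s_gt0 _))) normcX.
have -> : rho%:C ^+ N = (rho ^+ N)%:C by rewrite rmorphXn.
rewrite complexReM /= mul0r subr0 ler_wpM2l ?(ltW (binom_coef_gt0 s_gt0 _))//.
by rewrite lerXn2r ?nnegrE ?normc_ge0.
Qed.

Lemma bounded_measurable_binom_psum N (a : R[i]) :
  bounded_measurable (fun w => binom_psum s N (a * w)).
Proof.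
apply: bounded_measurable_sum => n; apply: bounded_measurableM.
  exact: bounded_measurable_cst.
apply: bounded_measurableX; apply: bounded_measurableM.
  exact: bounded_measurable_cst.
exact: bounded_measurable_id.
Qed.

(** The integrals of the truncated kernels have two limits: the Berezin transform, by bounded
    convergence, and the closed form, by orthogonality and the binomial series once more. Uniqueness
    of limits identifies them. *)
Lemma berezin_rotation (eta xi : R[i]) : Normc.normc eta = 1 -> disk xi ->
  berezin gamma (composition_operator (psi0 eta)) xi =
  (disk_area / pi * (1 - Normc.normc xi ^+ 2) `^ s)%:C /
    cpow (1 - eta * (Normc.normc xi ^+ 2)%:C) s.
Proof.
move=> eta1; rewrite /disk/= normr_lt1 => xi1.
pose A := ((1 - Normc.normc xi ^+ 2) `^ (s / 2))%:C.
(* The kernel at eta w is a power of 1 - a w and the kernel at w the same power of 1 - b w; the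
   series is later summed at a conj(b) = eta |xi|^2. *)
pose a := xi^*%C * eta; pose b := xi^*%C.
have na : Normc.normc a = Normc.normc xi by rewrite Normc.normcM normcJ_real eta1 mulr1.
have nb : Normc.normc b = Normc.normc xi by rewrite normcJ_real.
have [C hC] := binom_psum_bounded (normc_ge0 xi) xi1.
have nw c w : Normc.normc c = Normc.normc xi -> disk w -> Normc.normc (c * w) <= Normc.normc xi.
  rewrite /disk/= normr_lt1 => nc w1.
  by rewrite Normc.normcM nc ler_piMr ?normc_ge0// ltW.
pose F N w := (A * A) * (binom_psum s N (a * w) * (binom_psum s N (b * w))^*%C).
pose G w := normalized_kernel gamma xi (eta * w) * (normalized_kernel gamma xi w)^*%C.
have A_real : A^*%C = A by exact: conjc_real.
have cF : ccvg (fun N => integral_dA gamma (F N)) (integral_dA gamma G).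
  apply: (integral_dA_cvg gamma_gt (C := Normc.normc (A * A) * (C * C))).
  - move=> N; apply: bounded_measurableM; first exact: bounded_measurable_cst.
    apply: bounded_measurableM; first exact: bounded_measurable_binom_psum.
    by apply: bounded_measurableJ; exact: bounded_measurable_binom_psum.
  - move=> N w Dw; rewrite /F Normc.normcM ler_wpM2l ?normc_ge0//.
    rewrite Normc.normcM normcJ_real ler_pM ?normc_ge0//; apply: hC; exact: nw.
  - move=> w Dw; rewrite /F /G /normalized_kernel -/s.
    have lt1 c : Normc.normc c = Normc.normc xi -> Normc.normc (c * w) < 1.
      by move=> nc; exact: le_lt_trans (nw _ _ nc Dw) xi1.
    have c1 := cvg_binom_psum s_gt0 (lt1 a na).
    have c2 := cvg_binom_psum s_gt0 (lt1 b nb).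
    have cM (x y : R[i]) : (x * y)^*%C = x^*%C * y^*%C by exact: rmorphM.
    rewrite [xi^*%C * (eta * w)]mulrA -/a -/b -/A cM A_real mulrACA.
    by apply: ccvgM; [exact: ccvg_cst|apply: ccvgM => //; exact: ccvgJ].
have abE : a * b^*%C = eta * (Normc.normc xi ^+ 2)%:C.
  rewrite /a /b conjcK mulrAC mulrC; congr (_ * _).
  apply: eq_complexP; rewrite ?complexReM ?complexImM complexReJ complexImJ/=.
    by rewrite mulNr opprK sqr_normcE !expr2.
  by rewrite mulNr mulrC subrr.
have r1 : Normc.normc xi ^+ 2 < 1 by rewrite sqr_normc_lt1.
have ab1 : Normc.normc (a * b^*%C) < 1.
  by rewrite abE Normc.normcM eta1 mul1r normc_real ger0_norm ?sqr_ge0.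
have FE N : integral_dA gamma (F N) =
    A * A * ((weight_moment gamma 0)%:C * binom_psum s N (a * b^*%C)).
  rewrite /F integral_dAZ//; last first.
    apply: bounded_measurableM; first exact: bounded_measurable_binom_psum.
    by apply: bounded_measurableJ; exact: bounded_measurable_binom_psum.
  congr (_ * _); rewrite /binom_psum integral_dA_series// mulr_sumr.
  apply: eq_bigr => n _; rewrite mulrA -(weight_moment_binom n); congr (_ * _).
  rewrite expr2; have rM (x y : R) : (x * y)%:C = x%:C * y%:C by exact: (rmorphM (real_complex R)).
  by rewrite !rM; ring.
have cF' : ccvg (fun N => integral_dA gamma (F N))
    (A * A * ((weight_moment gamma 0)%:C * (cpow (1 - a * b^*%C) s)^-1)).
  rewrite (funext FE).
  apply: ccvgM; first exact: ccvg_cst.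
  by apply: ccvgM; [exact: ccvg_cst|exact: cvg_binom_psum].
rewrite -[LHS]/(integral_dA gamma G) (ccvg_unique cF cF') abE mulrA; congr (_ / _).
have rM (x y : R) : (x * y)%:C = x%:C * y%:C by exact: (rmorphM (real_complex R)).
rewrite /A -!rM weight_moment0 mulrC; congr (_ * _)%:C.
rewrite -powRD; last by rewrite -splitr (gt_eqF s_gt0).
by rewrite -splitr.
Qed.

End berezin_formula.

(** * The Berezin range *)

Section curve.
Context {R : realType}.

Lemma convexCP (A : set R[i]) : convexC A <->
  forall x y (t : R), A x -> A y -> 0 <= t <= 1 -> A (t%:C * x + (1 - t)%:C * y).
Proof.
have scE (t : R) (x : Rcomplex R) : t *: x = (t%:C * (x : R[i])).
  by case: x => a b; apply: eq_complexP => /=; rewrite !mul0r ?subr0 ?addr0.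
split=> [cA x y t Ax Ay /andP[t0 t1]|cA x y t].
  have := cA x y (Itv01 t0 t1); rewrite !inE => /(_ Ax Ay).
  by rewrite /conv/= !scE.
rewrite !inE => Ax Ay; have := cA x y t%:num Ax Ay; rewrite ge0 le1 => /(_ isT).
by rewrite /conv/= !scE.
Qed.

(** The derivative of [atan] is at most 1 in modulus. This will bound the argument of 1 - eta r by a
    ratio of its coordinates. *)
Lemma ler_norm_atan (u : R) : `|atan u| <= `|u|.
Proof.
have pos (v : R) : 0 <= v -> `|atan v| <= v.
  move=> v0; have [|c _] := @MVT_segment R atan (fun t => (1 + t ^+ 2)^-1) 0 v v0.
    by apply: derivable_within_continuous => t _; have [] := is_derive1_atan t.
  rewrite atan0 !subr0 => ->.
  rewrite ger0_norm ?mulr_ge0 ?invr_ge0 ?addr_ge0 ?sqr_ge0//.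
  by rewrite ler_piMl// invf_le1 ?lerDl ?ltr_pwDl ?sqr_ge0.
have [u0|u0] := leP 0 u; first by rewrite (ger0_norm u0) pos.
by rewrite (ltr0_norm u0) -[u in atan u]opprK atanN normrN pos// oppr_ge0 ltW.
Qed.

Lemma powR_le1 (x a : R) : 0 <= a -> 0 <= x -> x <= 1 -> x `^ a <= 1.
Proof.
move=> a0 x0 x1; have := @ge0_ler_powR R a a0 x 1.
by rewrite !nnegrE powR1; apply.
Qed.

Variables (K s : R) (eta : R[i]).
Hypotheses (K_gt0 : 0 < K) (s_gt1 : 1 < s) (eta1 : Normc.normc eta = 1).

(** The Berezin transform as a function of r = |xi|^2, to be used with K = [disk_area / pi] and s =
    gamma + 2. *)
Definition berezin_curve (r : R) : R[i] :=
  (K * (1 - r) `^ s)%:C / cpow (1 - eta * r%:C) s.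

Let B := berezin_curve.
Let c := complex.Re eta.

Let s_gt0 : 0 < s. Proof. exact: lt_trans s_gt1. Qed.

Let c2 : c ^+ 2 + complex.Im eta ^+ 2 = 1.
Proof. by rewrite -sqr_normcE eta1 expr1n. Qed.

Let n (r : R) := Normc.normc (1 - eta * r%:C).

Let n2 r : n r ^+ 2 = 1 - 2 * r * c + r ^+ 2.
Proof.
rewrite /n sqr_normcE (_ : complex.Re _ = 1 - c * r); last first.
  by rewrite /c; case: eta => a b /=; ring.
rewrite (_ : complex.Im _ = - (complex.Im eta * r)); last first.
  by case: eta => a b /=; ring.
have -> : (1 - c * r) ^+ 2 + (- (complex.Im eta * r)) ^+ 2 =
  1 - 2 * r * c + (c ^+ 2 + complex.Im eta ^+ 2) * r ^+ 2 by ring.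
by rewrite c2 mul1r.
Qed.

Let c_le1 : c <= 1.
Proof. by rewrite (le_trans (ler_norm _))// -eta1 ler_normc_Re. Qed.

Lemma normc_1B_gt0 r : 0 <= r < 1 -> 0 < n r.
Proof.
move=> /andP[r0 r1]; rewrite -(@ltr_sqr _ 0) ?nnegrE ?normc_ge0// expr0n/= n2.
have -> : 1 - 2 * r * c + r ^+ 2 = (1 - r) ^+ 2 + 2 * r * (1 - c) by ring.
by rewrite ltr_pwDl ?exprn_gt0 ?mulr_ge0 ?subr_gt0 ?subr_ge0.
Qed.

(** The modulus of the curve is K q^s. Writing n^2 = (1 - r)^2 + 2 r (1 - c) with c <= 1 shows that
    q lies in ]0, 1]. *)
Let q r := (1 - r) / n r.

Let q_gt0 r : 0 <= r < 1 -> 0 < q r.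
Proof. by move=> h; have /andP[_ r1] := h; rewrite divr_gt0 ?normc_1B_gt0// subr_gt0. Qed.

Let q_le1 r : 0 <= r < 1 -> q r <= 1.
Proof.
move=> h; have /andP[r0 r1] := h.
rewrite ler_pdivrMr ?normc_1B_gt0// mul1r -ler_sqr ?nnegrE ?normc_ge0 ?subr_ge0 ?(ltW r1)//.
rewrite n2; have -> : 1 - 2 * r * c + r ^+ 2 = (1 - r) ^+ 2 + 2 * r * (1 - c) by ring.
by rewrite lerDl ?mulr_ge0 ?subr_ge0.
Qed.

Lemma normc_berezin_curve r : 0 <= r < 1 -> Normc.normc (B r) = K * q r `^ s.
Proof.
move=> h; have /andP[r0 r1] := h.
rewrite /B /berezin_curve Normc.normcM Normc.normcV normc_cpow normc_real.
rewrite ger0_norm ?mulr_ge0 ?powR_ge0 ?(ltW K_gt0)// -mulrA; congr (_ * _).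
rewrite /q powRM ?subr_ge0 ?(ltW r1) ?invr_ge0 ?normc_ge0//; congr (_ * _).
by rewrite -/(n r) -powRN -mulN1r powRrM powR_inv1// normc_ge0.
Qed.

Lemma berezin_curve_neq0 r : 0 <= r < 1 -> B r != 0.
Proof.
move=> h; apply/eqP => /(congr1 (@Normc.normc R)).
rewrite normc_berezin_curve// Normc.normc0 => /eqP.
by rewrite gt_eqF// mulr_gt0// powR_gt0// q_gt0.
Qed.

Lemma berezin_curve0 : B 0 = K%:C.
Proof.
have cp1 : cpow (1 : R[i]) s = 1 by rewrite -[1 in LHS]/(1%:C) cpow_real// powR1.
by rewrite /B /berezin_curve mulr0 !subr0 cp1 powR1 mulr1 divr1.
Qed.

Lemma berezin_curve_realE (e r : R) : eta = e%:C -> 0 <= r < 1 -> 0 < 1 - e * r ->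
  B r = (K * ((1 - r) / (1 - e * r)) `^ s)%:C.
Proof.
move=> etaE /andP[r0 r1] er0; rewrite /B /berezin_curve.
have -> : 1 - eta * r%:C = (1 - e * r)%:C.
  by rewrite etaE; apply: eq_complexP => /=; ring.
rewrite cpow_real// powRM ?subr_ge0 ?(ltW r1) ?invr_ge0 ?(ltW er0)//.
rewrite -(powR_inv1 (ltW er0)) -powRrM mulN1r powRN mulrA.
have rM (x y : R) : (x * y)%:C = x%:C * y%:C by exact: (rmorphM (real_complex R)).
by rewrite [RHS]rM; congr (_ * _); rewrite -[LHS]/(_^-1) fmorphV.
Qed.

Lemma berezin_curve_real : eta = 1 \/ eta = -1 -> convexC (B @` [set r | 0 <= r < 1]).
Proof.
move=> eta_real; apply/convexCP => _ _ t [r1 h1 <-] [r2 h2 <-] t01.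
have h0 : 0 <= (0 : R) < 1 by rewrite lexx ltr01.
case: eta_real => etaE.
  have BE r : 0 <= r < 1 -> B r = K%:C.
    move=> h; have /andP[_ r1'] := h.
    rewrite (berezin_curve_realE (e := 1))// mul1r ?subr_gt0// divff ?gt_eqF ?subr_gt0//.
    by rewrite powR1 mulr1.
  exists 0 => //; rewrite !BE//.
  by apply: eq_complexP => /=; ring.
have etaE' : eta = (-1)%:C by rewrite etaE; apply: eq_complexP => //=; rewrite oppr0.
pose g (r : R) := K * ((1 - r) / (1 + r)) `^ s.
have BE r : 0 <= r < 1 -> B r = (g r)%:C.
  move=> h; have /andP[r0 r1'] := h.
  by rewrite (berezin_curve_realE (e := -1))// ?mulN1r ?opprK// ltr_pwDl.
have g0 r : 0 <= r < 1 -> 0 < g r <= K.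
  move=> /andP[r0 r1']; have p0 : 0 < (1 - r) / (1 + r).
    by rewrite divr_gt0 ?subr_gt0// ltr_pwDl.
  rewrite /g mulr_gt0 ?powR_gt0//= ler_piMr ?(ltW K_gt0)//.
  rewrite powR_le1 ?(ltW s_gt0) ?(ltW p0)//.
  by rewrite ler_pdivrMr ?mul1r ?ltr_pwDl//; lra.
have /andP[a1 b1] := g0 _ h1; have /andP[a2 b2] := g0 _ h2; have /andP[t0 t1] := t01.
pose v := t * g r1 + (1 - t) * g r2.
have v0 : 0 < v.
  rewrite /v; have [->|tn] := eqVneq t 0; first by rewrite mul0r subr0 mul1r add0r.
  have tp : 0 < t by rewrite lt_neqAle eq_sym tn.
  apply: ltr_pwDl; first exact: mulr_gt0.
  by apply: mulr_ge0; [rewrite subr_ge0|exact: ltW].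
have vK : v <= K.
  have -> : K = t * K + (1 - t) * K by ring.
  by rewrite /v lerD ?ler_wpM2l ?subr_ge0.
(* Solves g r = v: the map r |-> (1 - r) / (1 + r) is its own inverse, so r = (1 - u) / (1 + u). The
   curve thus fills the whole of ]0, K]. *)
pose u := (v / K) `^ s^-1.
have u0 : 0 < u by rewrite powR_gt0// divr_gt0.
have u1 : u <= 1.
  rewrite powR_le1 ?invr_ge0 ?(ltW s_gt0)//.
    by rewrite divr_ge0 ?ltW.
  by rewrite ler_pdivrMr ?mul1r.
have pu : 0 < 1 + u by rewrite ltr_pwDl ?(ltW u0).
have h : 0 <= (1 - u) / (1 + u) < 1.
  rewrite divr_ge0 ?subr_ge0 ?(ltW pu)//= ltr_pdivrMr// mul1r; lra.
exists ((1 - u) / (1 + u)) => //.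
rewrite !BE//; have -> : g ((1 - u) / (1 + u)) = v.
  rewrite /g (_ : (1 - _) / (1 + _) = u); last by field; rewrite !gt_eqF//; lra.
  rewrite /u -powRrM mulVf ?(gt_eqF s_gt0)// powRr1 ?divr_ge0 ?ltW//.
  by rewrite mulrC divfK// gt_eqF.
by apply: eq_complexP => /=; rewrite /v; ring.
Qed.

(** * The curve for eta different from 1 *)

Section nonconvex.
Hypothesis eta_neq1 : eta != 1.

Let c_lt1 : c < 1.
Proof.
rewrite lt_neqAle c_le1 andbT; apply: contra eta_neq1 => /eqP c1.
have b0 : complex.Im eta = 0.
  by apply/eqP; rewrite -sqrf_eq0; move: c2; rewrite c1 => ?; apply/eqP; lra.
by apply/eqP; apply: eq_complexP; rewrite /= -?/c.
Qed.

Lemma normc_berezin_curve_inj r1 r2 : 0 <= r1 < 1 -> 0 <= r2 < 1 ->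
  Normc.normc (B r1) = Normc.normc (B r2) -> r1 = r2.
Proof.
move=> h1 h2; rewrite !normc_berezin_curve// => /(mulfI (lt0r_neq0 K_gt0)).
move=> /(powR_injective s_gt0); rewrite !nnegrE !ltW ?q_gt0// => /(_ isT isT).
move=> qq; have : (1 - r1) ^+ 2 * n r2 ^+ 2 = (1 - r2) ^+ 2 * n r1 ^+ 2.
  rewrite -!exprMn; congr (_ ^+ 2); apply/eqP.
  rewrite -eqr_div; first by apply/eqP; exact: qq.
    by rewrite gt_eqF// normc_1B_gt0.
  by rewrite gt_eqF// normc_1B_gt0.
rewrite !n2 => E.
(* Substituting n^2 = (1 - r)^2 + 2 r (1 - c) on both sides of [E] leaves twice this product; c < 1
   and r1 r2 < 1 then force r1 = r2. *)
have : (1 - c) * ((r2 - r1) * (1 - r1 * r2)) = 0 by nra.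
move/eqP; rewrite !mulf_eq0 !subr_eq0 (gt_eqF c_lt1)/=.
have /andP[? ?] := h1; have /andP[? ?] := h2.
by case/orP => /eqP ?; [done|exfalso; nra].
Qed.

Lemma berezin_curve_small e : 0 < e -> exists2 r, 0 <= r < 1 & Normc.normc (B r) <= e.
Proof.
move=> e0; pose d := 1 - c; have d0 : 0 < d by rewrite subr_gt0.
have d2 : d <= 2.
  have := ler_normc_Re eta; rewrite eta1 ler_norml -/c /d => /andP[h _]; lra.
pose e' := e / K; have e'0 : 0 < e' by rewrite divr_gt0.
(* At r = 1 - dl one has q = dl / n and n^2 = dl^2 + 2 (1 - dl) d >= d since dl <= 1 / 2. As d <= 2
   this gives d / 2 <= n, so dl <= e' d / 2 yields q <= e'. *)
pose dl := Num.min 2^-1 (e' * d / 2).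
have dl0 : 0 < dl by rewrite lt_min invr_gt0 ltr0n/= !mulr_gt0 ?invr_gt0.
have dl1 : dl <= 2^-1 by rewrite ge_min lexx.
have dl2 : dl <= e' * d / 2 by rewrite ge_min lexx orbT.
have h : 0 <= 1 - dl < 1 by apply/andP; split; lra.
exists (1 - dl) => //; rewrite normc_berezin_curve//.
have q01 : 0 < q (1 - dl) <= 1 by rewrite q_gt0// q_le1.
(* Since s > 1 and 0 < q <= 1, q^s <= q. *)
apply: (@le_trans _ _ (K * q (1 - dl))).
  by rewrite ler_wpM2l ?(ltW K_gt0)// ge1r_powR// ltW.
rewrite mulrC -ler_pdivlMr// -/e' /q ler_pdivrMr ?normc_1B_gt0//.
have nn := ltW (normc_1B_gt0 h).
have rn := mulr_ge0 (ltW e'0) nn.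
suff h2 : dl ^+ 2 <= (e' * n (1 - dl)) ^+ 2.
  by rewrite subKr; move: h2; rewrite ler_sqr// nnegrE ltW.
rewrite exprMn n2.
have -> : 1 - 2 * (1 - dl) * c + (1 - dl) ^+ 2 = dl ^+ 2 + 2 * (1 - dl) * d.
  by rewrite /d; ring.
apply: (@le_trans _ _ ((e' * d / 2) ^+ 2)).
  by rewrite lerXn2r// ?nnegrE ?(ltW dl0)// ltW// !mulr_gt0// invr_gt0.
have -> : (e' * d / 2) ^+ 2 = e' ^+ 2 * (d * (d / 4)) by field.
rewrite ler_wpM2l ?sqr_ge0//.
by nra.
Qed.

Lemma berezin_curve_convex_Im r : convexC (B @` [set r | 0 <= r < 1]) ->
  0 <= r < 1 -> complex.Im (B r) = 0.
Proof.
move=> /convexCP cB h; apply/eqP; apply/negPn/negP => Im0.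
(* A finite form of the limit: a point of the segment from B r2 to the real number K has imaginary
   part at most |Im (B r2)| <= e in modulus. With e half of |Im (B r)|, that point cannot be B r. *)
pose e := `|complex.Im (B r)| / 2.
have e0 : 0 < e by rewrite divr_gt0 ?normr_gt0.
have [r2 h2 n2e] := berezin_curve_small e0.
have eI : e < `|complex.Im (B r)| by rewrite /e; move: e0; rewrite /e; lra.
have n2r : Normc.normc (B r2) <= Normc.normc (B r).
  by rewrite (le_trans n2e)// (le_trans (ltW eI))// ler_normc_Im.
have nrK : Normc.normc (B r) <= K.
  rewrite normc_berezin_curve// ler_piMr ?(ltW K_gt0)//.
  by rewrite powR_le1 ?(ltW s_gt0) ?(ltW (q_gt0 h)) ?q_le1.
(* The squared modulus along the segment is polynomial in t, hence continuous; it runs from |B r2|^2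
   to K^2, and |B r|^2 lies between. The term t * 0 keeps the shape handled by [cl]. *)
pose f (t : R) := (t * K + (1 - t) * complex.Re (B r2)) ^+ 2 +
  (t * 0 + (1 - t) * complex.Im (B r2)) ^+ 2.
have fE t : f t = Normc.normc (t%:C * K%:C + (1 - t)%:C * B r2) ^+ 2.
  rewrite sqr_normcE /f complexReD complexImD !complexReM !complexImM/=.
  by rewrite !(mul0r, mulr0, subr0, addr0, add0r).
have cl (x y : R) (t : R) : {for t, continuous (fun t : R => t * x + (1 - t) * y)}.
  by apply: cvgD; apply: cvgM; [exact: cvg_id|exact: cvg_cst|apply: cvgB;
    [exact: cvg_cst|exact: cvg_id]|exact: cvg_cst].
have cf : {within `[0, 1], continuous f}.
  apply/continuous_in_subspaceT => t _; apply: cvgD.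
    exact: (cvg_comp _ _ (cl _ _ t) (@exprn_continuous _ 2 _)).
  exact: (cvg_comp _ _ (cl _ _ t) (@exprn_continuous _ 2 _)).
have [|t] := @IVT R f 0 1 (Normc.normc (B r) ^+ 2) ler01 cf.
  rewrite !fE !mul0r subr0 mul1r add0r subrr mul1r mul0r addr0 normc_real.
  rewrite ge_min le_max (ger0_norm (ltW K_gt0)).
  by rewrite !ler_sqr ?nnegrE ?normc_ge0 ?(ltW K_gt0)// n2r nrK orbT.
move=> t01'; have t01 : 0 <= t <= 1 by move: t01'; rewrite in_itv.
rewrite fE => /eqP.
rewrite eqrXn2 ?normc_ge0// => /eqP nE.
have h0 : 0 <= (0 : R) < 1 by rewrite lexx ltr01.
have im0 : (B @` [set r | 0 <= r < 1]) (B 0) by exists 0.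
have im2 : (B @` [set r | 0 <= r < 1]) (B r2) by exists r2.
have [r' h' Er'] := cB _ _ t im0 im2 t01; rewrite berezin_curve0 in Er'.
have rr : r' = r by apply: normc_berezin_curve_inj => //; rewrite Er'.
move: Er'; rewrite rr => /(congr1 (@complex.Im R)).
have ImE (w : R[i]) : complex.Im (t%:C * K%:C + (1 - t)%:C * w) = (1 - t) * complex.Im w.
  by case: w => a b /=; ring.
rewrite ImE => E.
have : `|complex.Im (B r)| <= e.
  rewrite E normrM (le_trans _ n2e)// (le_trans _ (ler_normc_Im _))//.
  by rewrite ler_piMl// ger0_norm; move/andP: t01 => [? ?]; lra.
by rewrite leNgt eI.
Qed.

Lemma berezin_curve_not_convex : convexC (B @` [set r | 0 <= r < 1]) -> eta = -1.
Proof.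
(* Chosen so that s r = 1 - r. With x and y the coordinates of 1 - eta r, this gives x = 1 - c r >=
   s r and |y| <= r, so the angle s atan (y / x) is at most 1 < pi in modulus and its sine vanishes
   only at 0. *)
move=> cB; pose r := (s + 1)^-1.
have s1 : 0 < s + 1 by rewrite ltr_wpDr.
have r0 : 0 < r by rewrite invr_gt0.
have r1 : r < 1 by rewrite invf_lt1// ltrDr.
have h : 0 <= r < 1 by rewrite ltW.
have B0 := berezin_curve_neq0 h.
have Im0 := berezin_curve_convex_Im cB h.
have Re0 : complex.Re (B r) != 0.
  by apply: contra B0 => /eqP R0; apply/eqP; exact: eq_complexP.
pose P := cpow (1 - eta * r%:C) s.
have P0 : P != 0.
  by apply: contra B0 => /eqP; rewrite /B /berezin_curve -/P => ->; rewrite invr0 mulr0.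
have PB : P * B r = (K * (1 - r) `^ s)%:C by rewrite /B /berezin_curve mulrCA divff// mulr1.
have ImP : complex.Im P = 0.
  have /(congr1 (@complex.Im R)) := PB.
  rewrite complexImM Im0 mulr0 add0r => /eqP; rewrite mulf_eq0 (negbTE Re0) orbF.
  by move/eqP.
pose x := complex.Re (1 - eta * r%:C); pose y := complex.Im (1 - eta * r%:C).
have xE : x = 1 - c * r by rewrite /x /c; case: (eta) => a b /=; ring.
have yE : y = - (complex.Im eta * r).
  by rewrite /y; case: (eta) => a b /=; ring.
have x0 : s * r <= x.
  have sr : s * r = 1 - r by rewrite /r; field; rewrite gt_eqF.
  by rewrite sr xE lerD2l lerN2 ler_piMl// ltW.
have x_gt0 : 0 < x by rewrite (lt_le_trans _ x0)// mulr_gt0.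
have th : `|s * atan (y / x)| <= 1.
  rewrite normrM (gtr0_norm s_gt0) (@le_trans _ _ (s * `|y / x|))//.
    by rewrite ler_wpM2l ?(ltW s_gt0)// ler_norm_atan.
  rewrite normrM normfV (gtr0_norm x_gt0) mulrA ler_pdivrMr// mul1r (le_trans _ x0)//.
  rewrite ler_wpM2l ?(ltW s_gt0)// yE normrN normrM (gtr0_norm r0) ler_piMl ?(ltW r0)//.
  by rewrite -eta1 ler_normc_Im.
have pi1 : 1 < pi :> R.
  by have := @pi_ge2 R; lra.
have sin0 : sin (s * atan (y / x)) = 0.
  move: ImP; rewrite /P cpowE// -/x -/y complexImM/= mul0r addr0 => /eqP.
  by rewrite mulf_eq0 powR_eq0 (gt_eqF (ltr_pwDl _ _)) ?exprn_gt0 ?sqr_ge0//= => /eqP.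
have sinpos (v : R) : 0 < v -> v <= 1 -> sin v != 0.
  by move=> v0 v1; rewrite gt_eqF// sin_gt0_pi// v0 (le_lt_trans v1).
have at0 : atan (y / x) = 0.
  apply/eqP; have : s * atan (y / x) == 0.
    rewrite -[_ == _]negbK; apply/negP => nz.
    have [p0|p0|p0] := ltgtP (s * atan (y / x)) 0; last by rewrite p0 eqxx in nz.
      have := sinpos (- (s * atan (y / x))).
      rewrite oppr_gt0 sinN oppr_eq0 sin0 eqxx => /(_ p0) h1.
      by have /h1 : - (s * atan (y / x)) <= 1 by move: th; rewrite ltr0_norm.
    have := sinpos (s * atan (y / x)) p0; rewrite sin0 eqxx => h1.
    by have /h1 : s * atan (y / x) <= 1 by move: th; rewrite gtr0_norm.
  by rewrite mulf_eq0 (gt_eqF s_gt0).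
have y0 : y = 0.
  have : tan (atan (y / x)) = 0 by rewrite at0 tan0.
  by rewrite atanK => /eqP; rewrite mulf_eq0 invr_eq0 (gt_eqF x_gt0) orbF => /eqP.
have I0 : complex.Im eta = 0.
  by move/eqP: y0; rewrite yE oppr_eq0 mulf_eq0 (gt_eqF r0) orbF => /eqP.
have : (c - 1) * (c + 1) = 0.
  by rewrite -subr_sqr_1 -c2 I0; ring.
move/eqP; rewrite mulf_eq0 subr_eq0 (lt_eqF c_lt1)/= addr_eq0 => /eqP cN1.
by apply: eq_complexP; rewrite ?I0 /= ?oppr0.
Qed.

End nonconvex.

End curve.

(** * Boundedness and conclusion *)

Section holomorphic_measurable.
Context {R : realType}.
Local Notation lam := (@lebesgue_measure R).
Local Notation mu := (@lebesgue2 R).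
Local Notation R2 := (measurableTypeR R * measurableTypeR R)%type.
Local Notation D := (@point R @^-1` disk).

(** An open set is the union of the rational boxes it contains; the union is countable and each box
    is a rectangle of the product sigma-algebra. *)
Lemma measurable_open_plane (U : set R2) :
  (forall p, U p -> exists2 d : R, 0 < d & forall q : R2,
    `|q.1 - p.1| < d -> `|q.2 - p.2| < d -> U q) -> measurable U.
Proof.
move=> oU.
pose box (a b c d : rat) : set R2 :=
  `](ratr a : R), (ratr b : R)[ `*` `](ratr c : R), (ratr d : R)[.
(* The box itself or the empty set, according to whether the box lies inside U, so that the unions
   may range over all rationals. *)
pose V a b c d : set R2 := [set p | box a b c d p /\ box a b c d `<=` U].
have -> : U = \bigcup_a \bigcup_b \bigcup_c \bigcup_d V a b c d.
  apply/seteqP; split => [p Up|p [a _ [b _ [c _ [d _ [Bp]]]]]]; last by apply.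
  have [e e0 he] := oU _ Up.
  have near (x : R) : exists a b : rat,
    [/\ x - e < ratr a, ratr a < x, x < ratr b & ratr b < x + e].
    have [a] : exists q : rat, ratr q \in `](x - e), x[ by apply: rat_in_itvoo; rewrite gtrBl.
    have [b] : exists q : rat, ratr q \in `]x, (x + e)[ by apply: rat_in_itvoo; rewrite ltrDl.
    by rewrite !in_itv/= => /andP[? ?] /andP[? ?]; exists a, b.
  have [a [b [a1 a2 b1 b2]]] := near p.1; have [c [d [c1 c2 d1 d2]]] := near p.2.
  exists a => //; exists b => //; exists c => //; exists d => //; split.
    by split; rewrite /= in_itv/= ?a2 ?b1 ?c2 ?d1.
  move=> q [] /=; rewrite !in_itv/= => /andP[x1 x2] /andP[y1 y2].
  by apply: he; rewrite ltr_norml; apply/andP; split; lra.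
apply: bigcupT_measurable_rat => a; apply: bigcupT_measurable_rat => b.
apply: bigcupT_measurable_rat => c; apply: bigcupT_measurable_rat => d.
rewrite /V; have [h|h] := pselect (box a b c d `<=` U).
  rewrite (_ : [set _ | _] = box a b c d); first by apply: measurableX.
  by apply/seteqP; split => p => [[]|].
by rewrite (_ : [set _ | _] = set0)//; apply/seteqP; split => p => [[]|].
Qed.

Definition real_continuous_on_disk (g : R[i] -> R) : Prop :=
  forall z, disk z -> forall e : R, 0 < e ->
    exists2 d : R, 0 < d & forall w, Normc.normc (w - z) < d -> `|g w - g z| < e.

Lemma measurable_continuous_disk (g : R[i] -> R) : real_continuous_on_disk g ->
  measurable_fun D (g \o point).
Proof.
move=> cg mD; apply: (measurability _ (RGenOInfty.measurableE R)) => //.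
move=> /= _ [_ [a ->] <-]; rewrite preimage_itvoy.
apply: measurable_open_plane => p [Dp /= ap].
have [|d1 d10 h1] := cg _ Dp (g (point p) - a); first by rewrite subr_gt0.
have r0 : 0 < 1 - Normc.normc (point p) by rewrite subr_gt0 -normr_lt1.
(* The second bound keeps the neighbourhood inside the disk. Halving d passes from coordinatewise
   distance to the modulus by the triangle inequality. *)
pose d := Num.min d1 (1 - Normc.normc (point p)).
exists (d / 2) => [|q q1 q2]; first by rewrite divr_gt0// lt_min d10.
have nd : Normc.normc (point q - point p) < d.
  have -> : point q - point p = (q.1 - p.1)%:C + (q.2 - p.2)%:C * 'i%C.
    by apply: eq_complexP => /=; ring.
  rewrite (le_lt_trans (le_normcD _ _))// Normc.normcM !normc_real.
  have -> : Normc.normc ('i%C : R[i]) = 1 by rewrite /= expr0n add0r expr1n sqrtr1.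
  by rewrite mulr1 (splitr d) ltrD.
split=> /=.
  rewrite /disk/= normr_lt1 -[point q](subrK (point p)).
  rewrite (le_lt_trans (le_normcD _ _))// -ltrBrDr (lt_le_trans nd)//.
  by rewrite ge_min lexx orbT.
have := h1 (point q); rewrite (lt_le_trans nd) ?ge_min ?lexx// => /(_ isT).
by rewrite ltr_norml => /andP[]; lra.
Qed.

Lemma holomorphic_continuous (f : R[i] -> R[i]) : holomorphic_on_disk f ->
  forall z, disk z -> forall e : R, 0 < e ->
    exists2 d : R, 0 < d & forall w, Normc.normc (w - z) < d -> Normc.normc (f w - f z) < e.
Proof.
move=> hf z Dz e e0.
have : {for z, continuous (f : R[i]^o -> R[i]^o)}.
  by apply/differentiable_continuous/derivable1_diffP; exact: hf.
move=> /cvgrPdist_lt /(_ e%:C); rewrite ltcR => /(_ e0).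
(* The radius of a ball in R[i] is itself a complex number; its positivity forces the imaginary part
   d' to vanish. *)
move=> /nbhs_ballP[[d d'] /=]; rewrite ltcE/= => /andP[/eqP d'0 d0] h.
exists d => // w wz.
have distC (x y : R[i]) : `|x - y| = (Normc.normc (y - x))%:C.
  by rewrite complex_normrE -opprB normcN.
have : ball (z : R[i]^o) (d +i* d') w.
  by rewrite -ball_normE /ball_/= distC d'0 complexr0 ltcR.
by move=> /h /=; rewrite distC ltcR.
Qed.

(** [bergman] requires holomorphy and a finite integral, whereas the rotation invariance of
    integrals takes measurable integrands; this connects the two. *)
Lemma measurable_holomorphic (f : R[i] -> R[i]) : holomorphic_on_disk f ->
  measurable_fun D (fun p : R2 => complex.Re (f (point p))) /\
  measurable_fun D (fun p : R2 => complex.Im (f (point p))).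
Proof.
move=> /holomorphic_continuous cf; split.
  apply: (@measurable_continuous_disk (fun w => complex.Re (f w))).
  move=> z Dz e e0; have [d d0 h] := cf z Dz e e0; exists d => // w /h.
  apply: le_lt_trans; rewrite (le_trans _ (ler_normc_Re _))//.
  by case: (f w) (f z) => ? ? [? ?].
apply: (@measurable_continuous_disk (fun w => complex.Im (f w))).
move=> z Dz e e0; have [d d0 h] := cf z Dz e e0; exists d => // w /h.
apply: le_lt_trans; rewrite (le_trans _ (ler_normc_Im _))//.
by case: (f w) (f z) => ? ? [? ?].
Qed.

Lemma disk_mul (eta z : R[i]) : Normc.normc eta = 1 -> disk (eta * z) <-> disk z.
Proof. by move=> eta1; rewrite /disk/= !normr_lt1 Normc.normcM eta1 mul1r. Qed.

Lemma holomorphic_rotation (f : R[i] -> R[i]) (eta : R[i]) : Normc.normc eta = 1 ->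
  holomorphic_on_disk f -> holomorphic_on_disk (f \o psi0 eta).
Proof.
move=> eta1 hf z Dz; apply/derivable1_diffP.
apply: (@differentiable_comp _ _ _ _ (psi0 eta : R[i]^o -> R[i]^o) (f : R[i]^o -> R[i]^o)).
  by apply/derivable1_diffP; apply: derivableZ; exact: derivable_id.
by apply/derivable1_diffP; apply: hf; apply/disk_mul.
Qed.

(** Invariance of the weighted measure under rotations makes the operator an isometry, whence the
    constant 1. *)
Lemma composition_rotation_bounded (gamma : R) (eta : R[i]) : -1 < gamma ->
  Normc.normc eta = 1 ->
  bounded_linear_operator gamma (composition_operator (psi0 eta)).
Proof.
move=> gamma_gt eta1; split.
- move=> f [hf intf]; split; first exact: holomorphic_rotation.
  have [m1 m2] := measurable_holomorphic hf.
  pose g (p : R2) := (Normc.normc (f (point p)) ^+ 2 * weight gamma (point p))%:E.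
  have mg : measurable_fun D g.
    apply/measurable_EFinP; apply: measurable_funM; last first.
      by apply: measurable_funTS; exact: measurable_weight.
    under eq_fun do rewrite sqr_normcE.
    by apply: measurable_funD; exact: measurable_funX.
  apply: le_lt_trans intf; rewrite le_eqVlt; apply/orP; left; apply/eqP.
  transitivity (\int[mu]_(p in D) g (mul_point eta p))%E.
    by apply: eq_integral => p _; rewrite /g weight_mul// point_mul.
  exact: (integral_mul_point eta1 mg).
- by [].
- exists 1 => f [hf _]; rewrite mul1r.
  have [m1 m2] := measurable_holomorphic hf.
  pose g w := f w * (f w)^*%C.
  have gr : measurable_fun D (fun p : R2 => complex.Re (g (point p))).
    under eq_fun do rewrite complexReM complexReJ complexImJ.
    apply: measurable_funB; apply: measurable_funM => //.
    exact: measurable_funN.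
  have gi : measurable_fun D (fun p : R2 => complex.Im (g (point p))).
    under eq_fun do rewrite complexImM complexReJ complexImJ.
    apply: measurable_funD; apply: measurable_funM => //.
    exact: measurable_funN.
  have E : inner gamma (f \o psi0 eta) (f \o psi0 eta) = inner gamma f f.
    rewrite -[RHS](integral_dA_rotation gamma eta1 gr gi).
    exact: eq_integral_dA.
  by rewrite /bergman_norm /composition_operator E.
Qed.

End holomorphic_measurable.

(** The transform depends on xi only through r = |xi|^2, which sweeps [0, 1[. *)
Lemma berezin_range_curve (R : realType) (gamma : R) (eta : R[i]) : -1 < gamma ->
  Normc.normc eta = 1 ->
  berezin_range gamma (composition_operator (psi0 eta)) =
  berezin_curve (disk_area / pi) (gamma + 2) eta @` [set r | 0 <= r < 1].
Proof.
move=> gamma_gt eta1; apply/seteqP; split => [_ [xi Dxi <-]|_ [r /= /andP[r0 r1] <-]].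
  exists (Normc.normc xi ^+ 2); last by rewrite berezin_rotation.
  by rewrite /= sqr_ge0 sqr_normc_lt1 -normr_lt1.
have nr : Normc.normc ((Num.sqrt r)%:C) ^+ 2 = r.
  by rewrite normc_real ger0_norm ?sqrtr_ge0// sqr_sqrtr.
have Dr : disk (Num.sqrt r)%:C by rewrite /disk/= normr_lt1 -sqr_normc_lt1 nr.
by exists (Num.sqrt r)%:C => //; rewrite berezin_rotation// nr.
Qed.

Theorem theorem4p2 (R : realType) (gamma : R) (eta : R[i]) :
  -1 < gamma -> `|eta| = 1 ->
  bounded_linear_operator gamma (composition_operator (psi0 eta)) /\
  (convexC (berezin_range gamma (composition_operator (psi0 eta))) <->
   eta = 1 \/ eta = -1).
Proof.
move=> gamma_gt /normr_eq1 eta1; split; first exact: composition_rotation_bounded.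
have K0 : 0 < disk_area / pi :> R by rewrite divr_gt0 ?disk_area_gt0 ?pi_gt0.
have s1 : 1 < gamma + 2 by lra.
rewrite berezin_range_curve//; split => [cB|]; last exact: berezin_curve_real.
have [->|eta_neq1] := eqVneq eta 1; first by left.
by right; exact: berezin_curve_not_convex cB.
Qed.
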